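(* Let $R$ be an arbitrary commutative ring and $l\geq 3$. Let $\phi\colon \mathrm{StSp}(2l,R)\to \mathrm{Ep}(2l,R)$ be the natural projection from the symplectic Steinberg group onto the elementary symplectic group, $X_{ij}(a)\mapsto T_{ij}(a)$, and let $\mathrm{K_2Sp}(2l,R)=\mathrm{Ker}\,\phi$. Then $\mathrm{K_2Sp}(2l,R)$ is contained in the centre of $\mathrm{StSp}(2l,R)$; in other words, $\phi$ is a central extension.
   Context: Rings are associative, commutative and unital. $V=R^{2l}$ is the free right $R$-module with basis $e_{-l},\dots,e_{-1},e_1,\dots,e_l$; indices $i,j,h,k$ run over $\{-l,\dots,-1,1,\dots,l\}$. Write $\varepsilon_i=\mathrm{sgn}(i)\in\{1,-1\}$. The symplectic form is the bilinear form with $\langle e_i,e_j\rangle=\varepsilon_i\delta_{i,-j}$, and $\mathrm{Sp}(2l,R)$ is the group of $R$-linear automorphisms of $V$ preserving it. Commutators are $[x,y]=xyx^{-1}y^{-1}$. For $u,v\in V$ with $\langle u,v\rangle=0$ and $a\in R$, $T(u,v,a)\in\mathrm{Sp}(2l,R)$ is the map $w\mapsto w+u(\langle v,w\rangle+a\langle u,w\rangle)+v\langle u,w\rangle$. Put $T_{ij}(a)=T(e_i,e_{-j}a\varepsilon_{-j},0)$ for $i\notin\{\pm j\}$ and $T_{i,-i}(a)=T(e_i,0,a)$. The elementary symplectic group $\mathrm{Ep}(2l,R)$ is the subgroup of $\mathrm{Sp}(2l,R)$ generated by all $T_{ij}(a)$, $i\ne j$, $a\in R$. The symplectic Steinberg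 group $\mathrm{StSp}(2l,R)$ is the group generated by symbols $X_{ij}(a)$, $i\neq j$, $a\in R$, subject to the relations (each imposed only when all symbols in it are defined, i.e. no symbol $X_{ii}$ appears): R0: $X_{ij}(a)=X_{-j,-i}(-a\varepsilon_i\varepsilon_j)$; R1: $X_{ij}(a)X_{ij}(b)=X_{ij}(a+b)$; R2: $[X_{ij}(a),X_{hk}(b)]=1$ for $h\notin\{j,-i\}$, $k\notin\{i,-j\}$; R3: $[X_{ij}(a),X_{jk}(b)]=X_{ik}(ab)$ for $i\notin\{-j,-k\}$, $j\ne -k$; R4: $[X_{i,-i}(a),X_{-i,j}(b)]=X_{ij}(ab\varepsilon_i)X_{-j,j}(-ab^2)$; R5: $[X_{ij}(a),X_{j,-i}(b)]=X_{i,-i}(2ab\varepsilon_i)$. The assignment $X_{ij}(a)\mapsto T_{ij}(a)$ defines the natural epimorphism $\phi$. *)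

(* Defs.v *)
From HB Require Import structures.
From mathcomp Require Import all_boot all_order all_algebra ring.
From mathcomp Require Import generic_quotient boolp classical_sets.

Set Implicit Arguments.
Unset Strict Implicit.
Unset Printing Implicit Defensive.

Import GRing.Theory.

Local Open Scope classical_set_scope.
Local Open Scope quotient_scope.

Section AbstractGroups.
Local Open Scope group_scope.

Definition is_subgroup (G : groupType) (H : set G) : Prop :=
  [/\ H 1, forall x y, H x -> H y -> H (x * y) & forall x, H x -> H x^-1].

Definition generated_by (G : groupType) (S : set G) : set G :=
  smallest (@is_subgroup G) S.

Definition group_center (G : groupType) : set G :=
  [set x | forall y, x * y = y * x].

Definition group_kernel (G H : groupType) (f : G -> H) : set G :=
  [set x | f x = 1].

Definition central_extension (G H : groupType)
    (f : {multiplicative G -> H}) : Prop :=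
  (forall y, exists x, f x = y) /\ group_kernel f `<=` @group_center G.

Lemma generated_by_sub (G : groupType) (S : set G) : S `<=` generated_by S.
Proof. exact: sub_gen_smallest. Qed.

Lemma generated_by_subgroup (G : groupType) (S : set G) :
  is_subgroup (generated_by S).
Proof.
split.
- by move=> H [[]].
- move=> x y Sx Sy H HS; have [[_ HM _] _] := HS.
  by apply: HM; [exact: Sx | exact: Sy].
- move=> x Sx H HS; have [[_ _ HV] _] := HS.
  by apply: HV; exact: Sx.
Qed.

End AbstractGroups.

Arguments group_center G : clear implicits.

(* Groups given by generators and relations. A letter (g, false) stands for    *)
(* the generator g and (g, true) for its formal inverse.                       *)
Section Words.
Variable X : choiceType.

Definition word := seq (X * bool).

Definition wgen (g : X) : word := [:: (g, false)].

Definition winv (w : word) : word := rev [seq (p.1, ~~ p.2) | p <- w].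

(* [u, v] = u v u^-1 v^-1, unlike mathcomp's [~ u, v] = u^-1 v^-1 u v.         *)
Definition wcomm (u v : word) : word := u ++ v ++ winv u ++ winv v.

Lemma winvK : involutive winv.
Proof.
move=> w; rewrite /winv map_rev revK -map_comp -[RHS]map_id.
by apply: eq_map => -[g b] /=; rewrite negbK.
Qed.

Lemma winv_cat u v : winv (u ++ v) = winv v ++ winv u.
Proof. by rewrite /winv map_cat rev_cat. Qed.

End Words.

Section Presentation.
Variables (X : choiceType) (rel : word X -> word X -> Prop).

Inductive pres_equiv : word X -> word X -> Prop :=
| PresRel u v of rel u v : pres_equiv u v
| PresCancel g b : pres_equiv [:: (g, b); (g, ~~ b)] [::]
| PresCat u u' v v' of pres_equiv u u' & pres_equiv v v' :
    pres_equiv (u ++ v) (u' ++ v')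
| PresRefl u : pres_equiv u u
| PresSym u v of pres_equiv u v : pres_equiv v u
| PresTrans u v w of pres_equiv u v & pres_equiv v w : pres_equiv u w.

Definition pres_eqb (u v : word X) : bool := `[< pres_equiv u v >].

Lemma pres_eqb_refl : reflexive pres_eqb.
Proof. by move=> u; apply/asboolP; exact: PresRefl. Qed.

Lemma pres_eqb_sym : symmetric pres_eqb.
Proof. by move=> u v; apply/asboolP/asboolP; exact: PresSym. Qed.

Lemma pres_eqb_trans : transitive pres_eqb.
Proof.
by move=> v u w /asboolP uv /asboolP vw; apply/asboolP; exact: PresTrans vw.
Qed.

Canonical pres_eqv := EquivRel pres_eqb pres_eqb_refl pres_eqb_sym pres_eqb_trans.

Definition presented : Type := {eq_quot pres_eqv}.

HB.instance Definition _ := Choice.on presented.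

Definition pclass (w : word X) : presented := \pi_{eq_quot pres_eqv} w.

Lemma pclassP u v : pclass u = pclass v <-> pres_equiv u v.
Proof.
split=> [/eqmodP/asboolP //|uv].
by apply/eqmodP/asboolP.
Qed.

Definition prepr (x : presented) : word X := repr (x : {eq_quot pres_eqv}).

Lemma preprK : cancel prepr pclass.
Proof. exact: reprK. Qed.

Lemma prepr_class u : pres_equiv (prepr (pclass u)) u.
Proof. by apply/pclassP; rewrite preprK. Qed.

Lemma winv_cancel w : pres_equiv (w ++ winv w) [::].
Proof.
elim: w => [|[g b] w IHw]; first exact: PresRefl.
rewrite -cat1s winv_cat -!catA (catA w).
apply: PresTrans (PresCancel g b).
apply: (PresCat (u' := [:: (g, b)]) (v' := [:: (g, ~~ b)])).
  exact: PresRefl.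
by apply: (PresCat (u' := [::])) => //; exact: PresRefl.
Qed.

Lemma pres_equiv_winv u v : pres_equiv u v -> pres_equiv (winv u) (winv v).
Proof.
move=> uv.
apply: (@PresTrans _ (winv u ++ (v ++ winv v))).
  rewrite -[X in pres_equiv X _]cats0.
  by apply: PresCat; [exact: PresRefl | exact/PresSym/winv_cancel].
rewrite catA -[X in pres_equiv _ X]cat0s.
apply: PresCat; last exact: PresRefl.
apply: (@PresTrans _ (winv u ++ u)).
  by apply: PresCat; [exact: PresRefl | exact: PresSym].
by rewrite -{2}[u]winvK; exact: winv_cancel.
Qed.

Definition pmul (x y : presented) := pclass (prepr x ++ prepr y).
Definition pone : presented := pclass [::].
Definition pinv (x : presented) := pclass (winv (prepr x)).

Lemma pmulE u v : pmul (pclass u) (pclass v) = pclass (u ++ v).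
Proof. by apply/pclassP/PresCat; exact: prepr_class. Qed.

Lemma pinvE u : pinv (pclass u) = pclass (winv u).
Proof. by apply/pclassP/pres_equiv_winv; exact: prepr_class. Qed.

Lemma pmulA : associative pmul.
Proof.
move=> x y z; rewrite -[x]preprK -[y]preprK -[z]preprK.
by rewrite !pmulE catA.
Qed.

Lemma pmul1 : left_id pone pmul.
Proof. by move=> x; rewrite -[x]preprK pmulE. Qed.

Lemma p1mul : right_id pone pmul.
Proof. by move=> x; rewrite -[x]preprK pmulE cats0. Qed.

Lemma pmulV : right_inverse pone pinv pmul.
Proof.
by move=> x; rewrite -[x]preprK pinvE pmulE; apply/pclassP/winv_cancel.
Qed.

Lemma pVmul : left_inverse pone pinv pmul.
Proof.
move=> x; rewrite -[x]preprK pinvE pmulE -{2}[prepr x]winvK.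
by apply/pclassP/winv_cancel.
Qed.

HB.instance Definition _ := isGroup.Build presented pmulA pmul1 p1mul pVmul pmulV.

Lemma pclassM u v : pclass (u ++ v) = (pclass u * pclass v)%g.
Proof. by rewrite -pmulE. Qed.

Lemma pclassV u : pclass (winv u) = (pclass u)^-1%g.
Proof. by rewrite -pinvE. Qed.

Section Lift.
Variables (G : groupType) (f : X -> G).

Definition weval (w : word X) : G :=
  (\prod_(p <- w) (if p.2 then (f p.1)^-1 else f p.1))%g.

Lemma weval_cat u v : weval (u ++ v) = (weval u * weval v)%g.
Proof. exact: big_cat. Qed.

Lemma weval_gen g : weval (wgen g) = f g.
Proof. exact: big_seq1. Qed.

Lemma weval_inv w : weval (winv w) = (weval w)^-1%g.
Proof.
elim: w => [|[g b] w IHw]; first by rewrite /weval /winv big_nil invg1.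
rewrite -cat1s winv_cat !weval_cat IHw invgM; congr (_ * _)%g.
by rewrite /weval !big_seq1 /=; case: b; rewrite ?invgK.
Qed.

Lemma weval_comm u v :
  weval (wcomm u v) =
    (weval u * weval v * (weval u)^-1 * (weval v)^-1)%g.
Proof. by rewrite /wcomm !weval_cat !weval_inv !mulgA. Qed.

Hypothesis f_rel : forall u v, rel u v -> weval u = weval v.

Lemma weval_equiv u v : pres_equiv u v -> weval u = weval v.
Proof.
elim=> {u v} [u v /f_rel //|g b|u u' v v' _ IHu _ IHv|//|//|u v w _ -> _ -> //].
  by rewrite /weval !big_cons big_nil mulg1; case: b; rewrite ?mulgV ?mulVg.
by rewrite !weval_cat IHu IHv.
Qed.

Definition plift of (forall u v, rel u v -> weval u = weval v) :=
  fun x : presented => weval (prepr x).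

Local Notation lift := (plift f_rel).

Lemma plift_class w : lift (pclass w) = weval w.
Proof. by apply: weval_equiv; exact: prepr_class. Qed.

Lemma pliftF : {morph lift : x y / (x / y)%g}.
Proof.
have liftM : {morph lift : x y / (x * y)%g}.
  move=> x y; rewrite -[x]preprK -[y]preprK -pclassM !plift_class.
  exact: weval_cat.
move=> x y; rewrite liftM; congr (_ * _)%g.
apply: (@mulgI _ (lift y)); rewrite -liftM !mulgV.
by rewrite (plift_class [::]) /weval big_nil.
Qed.

HB.instance Definition _ := isGroupMorphism.Build _ _ lift pliftF.

End Lift.
End Presentation.

Section Symplectic.
Local Open Scope ring_scope.
Variables (l : nat) (R : comPzRingType).

(* The index k + 1 is encoded as (true, k), the index - (k + 1) as (false, k). *)
Definition idx : finType := (bool * 'I_l)%type.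

Definition iopp (i : idx) : idx := (~~ i.1, i.2).

Definition eps (i : idx) : R := if i.1 then 1 else -1.

(* R^o rather than R, so that V gets its R-module structure.                   *)
Definition V : lmodType R := {ffun idx -> R^o}.

Definition ebas (i : idx) : V := [ffun m => (m == i)%:R].

Definition form (u v : V) : R := \sum_i eps i * u i * v (iopp i).

Lemma oppK : involutive iopp.
Proof. by case=> b k; rewrite /iopp /= negbK. Qed.

Lemma eq_opp i j : (iopp i == iopp j) = (i == j).
Proof. exact: (inj_eq (inv_inj oppK)). Qed.

Lemma eq_oppl i j : (iopp i == j) = (i == iopp j).
Proof. by rewrite -eq_opp oppK. Qed.

Lemma opp_neq i : iopp i != i.
Proof. by rewrite -pair_eqE /= negb_and; case: i => -[]. Qed.

Lemma eps_opp i : eps (iopp i) = - eps i.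
Proof. by rewrite /eps /=; case: i.1; rewrite ?opprK. Qed.

Lemma epsP i : eps i = 1 \/ eps i = -1.
Proof. by rewrite /eps; case: i.1; [left | right]. Qed.

Lemma form_e_l i v : form (ebas i) v = eps i * v (iopp i).
Proof.
rewrite /form (bigD1 i) //= big1 ?addr0 => [|j /negPf ji].
  by rewrite ffunE eqxx mulr1.
by rewrite ffunE ji mulr0 mul0r.
Qed.

Lemma form_e i j : form (ebas i) (ebas j) = eps i * (i == iopp j)%:R.
Proof. by rewrite form_e_l ffunE eq_oppl. Qed.

Lemma form_linear_r u : scalar (form u).
Proof.
move=> a v w; rewrite /form big_distrr -big_split /=; apply: eq_bigr => i _.
by rewrite !ffunE /=; rewrite /GRing.scale /=; ring.
Qed.

Lemma form_anti u v : form u v = - form v u.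
Proof.
rewrite /form (reindex_inj (inv_inj oppK)) -sumrN; apply: eq_bigr => i _.
by rewrite oppK eps_opp; ring.
Qed.

Lemma form_linear_l v : scalar (form^~ v).
Proof.
move=> a u w; rewrite !(form_anti _ v) (form_linear_r v a u w); ring.
Qed.

Lemma form_alt u : form u u = 0.
Proof.
rewrite /form (bigID (fun i : idx => i.1)) /=.
rewrite [X in _ + X](reindex_inj (inv_inj oppK)) /=.
rewrite [X in _ + X](eq_bigl (fun i : idx => i.1)); last first.
  by move=> i; rewrite /iopp /= negbK.
rewrite -big_split big1 // => i _ /=.
by rewrite oppK eps_opp; ring.
Qed.

Lemma formDl u u' v : form (u + u') v = form u v + form u' v.
Proof. by rewrite -{1}[u]scale1r (form_linear_l v 1 u u') mul1r. Qed.

Lemma formDr u v v' : form u (v + v') = form u v + form u v'.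
Proof. by rewrite -{1}[v]scale1r (form_linear_r u 1 v v') mul1r. Qed.

Lemma formZl a u v : form (a *: u) v = a * form u v.
Proof.
have h0 : form 0 v = 0 by rewrite /form big1 // => i _; rewrite ffunE mulr0 mul0r.
by rewrite -[a *: u]addr0 (form_linear_l v a u 0) h0 addr0.
Qed.

Lemma formZr a u v : form u (a *: v) = a * form u v.
Proof. by rewrite form_anti formZl (form_anti v) mulrN opprK. Qed.

Definition formE := (formDl, formDr, formZl, formZr).

Definition symplectic : pred (V -> V) := fun f =>
  `[< [/\ linear f, bijective f & forall u v, form (f u) (f v) = form u v] >].

Definition Sp : Type := {f : V -> V | symplectic f}.

HB.instance Definition _ := SubChoice.on Sp.

Definition sp_fun (s : Sp) : V -> V := val s.
Coercion sp_fun : Sp >-> Funclass.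

Lemma SpP (s t : Sp) : (forall v, s v = t v) -> s = t.
Proof. by move=> st; apply: val_inj; apply: functional_extensionality_dep. Qed.

Lemma id_symplectic : symplectic id.
Proof. by apply/asboolP; split=> //; exists id. Qed.

Lemma comp_symplectic (s t : Sp) : symplectic (s \o t).
Proof.
have [/asboolP[ls bs fs] /asboolP[lt bt ft]] := (valP s, valP t).
apply/asboolP; split; last by move=> u v; rewrite /= fs ft.
- move=> a u v.
  have -> : (s \o t) (a *: u + v) = s (a *: t u + t v).
    by congr (val s _); exact: lt.
  exact: ls.
- exact: bij_comp.
Qed.

Lemma symplectic_inv_ex (s : Sp) : exists t : Sp, cancel s t /\ cancel t s.
Proof.
have /asboolP[ls bs fs] := valP s; have [g sK gK] := bs.
have sgK w : val s (g w) = w by exact: gK.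
suff gP : symplectic g by exists (Sub g gP).
apply/asboolP; split.
- move=> a u v; apply: (bij_inj bs); rewrite sgK.
  have -> : val s (a *: g u + g v) = a *: val s (g u) + val s (g v).
    exact: ls.
  by rewrite !sgK.
- by exists (val s).
- by move=> u v; rewrite -fs !sgK.
Qed.

Definition sp_one : Sp := Sub id id_symplectic.
Definition sp_mul (s t : Sp) : Sp := Sub (s \o t) (comp_symplectic s t).
Definition sp_inv (s : Sp) : Sp := sval (cid (symplectic_inv_ex s)).

Lemma sp_mulA : associative sp_mul. Proof. by move=> r s t; apply: SpP. Qed.
Lemma sp_mul1 : left_id sp_one sp_mul. Proof. by move=> s; apply: SpP. Qed.
Lemma sp_1mul : right_id sp_one sp_mul. Proof. by move=> s; apply: SpP. Qed.

Lemma sp_mulV : right_inverse sp_one sp_inv sp_mul.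
Proof. by move=> s; apply: SpP => v; case: (svalP (cid (symplectic_inv_ex s))) => _; exact. Qed.

Lemma sp_Vmul : left_inverse sp_one sp_inv sp_mul.
Proof. by move=> s; apply: SpP => v; case: (svalP (cid (symplectic_inv_ex s))) => + _; exact. Qed.

HB.instance Definition _ :=
  isGroup.Build Sp sp_mulA sp_mul1 sp_1mul sp_Vmul sp_mulV.

Lemma sp_mulE (s t : Sp) v : sp_fun (s * t)%g v = s (t v).
Proof. by []. Qed.

Definition transv (u v : V) (a : R) : V -> V := fun w =>
  w + (form v w + a * form u w) *: u + form u w *: v.

Lemma transvK u v a : form u v = 0 ->
  cancel (transv u v a) (transv u (- v) (- a)).
Proof.
move=> uv w; have vu : form v u = 0 by rewrite form_anti uv oppr0.
rewrite /transv -[- v]scaleN1r !formE !form_alt uv vu.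
by apply/ffunP => m; rewrite !ffunE /GRing.scale /=; ring.
Qed.

Lemma transv_symplectic u v a : form u v = 0 -> symplectic (transv u v a).
Proof.
move=> uv; have vu : form v u = 0 by rewrite form_anti uv oppr0.
apply/asboolP; split.
- move=> b w w'; rewrite /transv !formE.
  by apply/ffunP => m; rewrite !ffunE /GRing.scale /=; ring.
- exists (transv u (- v) (- a)); first exact: transvK.
  have uv' : form u (- v) = 0 by rewrite -scaleN1r formZr uv mulr0.
  by move=> w; have := transvK (- a) uv' w; rewrite !opprK.
- move=> w w'; rewrite /transv !formE !form_alt uv vu.
  by rewrite (form_anti w u) (form_anti w v); ring.
Qed.

Definition transvection (u v : V) (a : R) (uv : form u v = 0) : Sp :=
  Sub (transv u v a) (transv_symplectic a uv).

(* T_ij(a) = T(e_i, Tvec i j a, Tcoef i j a), i.e. T(e_i, 0, a) if j = -i and   *)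
(* T(e_i, e_{-j} a eps_{-j}, 0) otherwise.                                     *)
Definition Tvec (i j : idx) (a : R) : V :=
  if j == iopp i then 0 else (a * eps (iopp j)) *: ebas (iopp j).

Definition Tcoef (i j : idx) (a : R) : R := if j == iopp i then a else 0.

Lemma Tvec_orth i j a : i != j -> form (ebas i) (Tvec i j a) = 0.
Proof.
move=> ij; rewrite /Tvec; case: ifP => _.
  by rewrite form_e_l ffunE mulr0.
by rewrite formZr form_e oppK (negPf ij) !mulr0.
Qed.

Definition elem (i j : idx) (ij : i != j) (a : R) : Sp :=
  transvection (Tcoef i j a) (Tvec_orth a ij).

Definition elementary : set Sp :=
  [set s | exists i j (ij : i != j) a, s = elem ij a].

Definition in_Ep : pred Sp := fun s => `[< generated_by elementary s >].

Definition Ep : Type := {s : Sp | in_Ep s}.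

HB.instance Definition _ := SubChoice.on Ep.

Lemma in_Ep_group_closed : group_closed in_Ep.
Proof.
have [h1 hM hV] := generated_by_subgroup elementary.
split=> [|s t /asboolP hs /asboolP ht]; first exact/asboolP.
by apply/asboolP; apply: hM => //; exact: hV.
Qed.

HB.instance Definition _ :=
  SubChoice_isSubGroup.Build Sp in_Ep Ep in_Ep_group_closed.

Lemma elem_in_Ep i j (ij : i != j) a : in_Ep (elem ij a).
Proof. by apply/asboolP; apply: generated_by_sub; exists i, j, ij, a. Qed.

Definition Ep_elem i j (ij : i != j) (a : R) : Ep :=
  Sub (elem ij a) (elem_in_Ep ij a).

Definition offdiag := {p : idx * idx | p.1 != p.2}.
Definition symbol : choiceType := (offdiag * R)%type.

Definition symX (i j : idx) (ij : i != j) (a : R) : word symbol :=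
  wgen (exist (fun p : idx * idx => p.1 != p.2) (i, j) ij, a).

(* The inequalities required for the symbols to make sense appear as proof     *)
(* arguments of symX; the remaining ones are the side conditions.              *)
Inductive st_rel : word symbol -> word symbol -> Prop :=
| StR0 i j a (ij : i != j) (ji' : iopp j != iopp i) :
    st_rel (symX ij a) (symX ji' (- (a * eps i * eps j)))
| StR1 i j a b (ij : i != j) :
    st_rel (symX ij a ++ symX ij b) (symX ij (a + b))
| StR2 i j h k a b (ij : i != j) (hk : h != k) :
    h != j -> h != iopp i -> k != i -> k != iopp j ->
    st_rel (wcomm (symX ij a) (symX hk b)) [::]
| StR3 i j k a b (ij : i != j) (jk : j != k) (ik : i != k) :
    i != iopp j -> i != iopp k -> j != iopp k ->
    st_rel (wcomm (symX ij a) (symX jk b)) (symX ik (a * b))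
| StR4 i j a b (ii' : i != iopp i) (i'j : iopp i != j)
    (ij : i != j) (j'j : iopp j != j) :
    st_rel (wcomm (symX ii' a) (symX i'j b))
           (symX ij (a * b * eps i) ++ symX j'j (- (a * b ^+ 2)))
| StR5 i j a b (ij : i != j) (ji' : j != iopp i) (ii' : i != iopp i) :
    st_rel (wcomm (symX ij a) (symX ji' b)) (symX ii' (2%:R * a * b * eps i)).

Definition StSp : groupType := presented st_rel.

Definition x_ (i j : idx) (ij : i != j) (a : R) : StSp :=
  pclass st_rel (symX ij a).

Definition symbol_elem (g : symbol) : Ep := Ep_elem (proj2_sig g.1) g.2.

Lemma elem_long i j (ij : i != j) a w m : j != iopp i ->
  elem ij a w m = w m + a * (m == i)%:R * w j
    - a * eps i * eps j * (m == iopp j)%:R * w (iopp i).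
Proof.
move=> ji; rewrite [elem ij a w]/(transv _ _ _ w) /transv /Tvec /Tcoef.
rewrite (negPf ji) formZl !form_e_l !ffunE /GRing.scale /= oppK eps_opp.
by case: (epsP j) => ->; ring.
Qed.

Lemma elem_short i j (ij : i != j) a w m : j = iopp i ->
  elem ij a w m = w m + a * eps i * (m == i)%:R * w j.
Proof.
move=> ji; subst j.
rewrite [elem ij a w]/(transv _ _ _ w) /transv /Tvec /Tcoef eqxx.
have -> : form 0 w = 0.
  by rewrite /form big1 // => k _; rewrite ffunE mulr0 mul0r.
by rewrite !form_e_l !ffunE /GRing.scale /=; ring.
Qed.

Lemma elem_gen i j (ij : i != j) a : exists c d, forall w m,
  elem ij a w m = w m + c * (m == i)%:R * w j
    - d * (m == iopp j)%:R * w (iopp i).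
Proof.
have [ji|ji] := eqVneq j (iopp i).
  by exists (a * eps i), 0 => w m; rewrite elem_short // !mul0r subr0.
exists a, (a * eps i * eps j) => w m; exact: elem_long.
Qed.

Lemma Sp_commE (A B C : Sp) : (forall w m, A (B w) m = C (B (A w)) m) ->
  (A * B * A^-1 * B^-1)%g = C.
Proof.
move=> ABC; apply/eqP; rewrite !divg_eq; apply/eqP.
by apply: SpP => w; apply/ffunP => m; rewrite !sp_mulE ABC.
Qed.

Lemma neqE (i j : idx) : i != j ->
  ((i == j) = false) * ((j == i) = false) *
  ((iopp i == iopp j) = false) * ((iopp j == iopp i) = false).
Proof. by move=> /negPf ij; rewrite !eq_opp (eq_sym j) ij. Qed.

Lemma neq_oppE (i j : idx) : i != iopp j ->
  ((i == iopp j) = false) * ((iopp j == i) = false) *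
  ((iopp i == j) = false) * ((j == iopp i) = false).
Proof.
by move=> /negPf ij; rewrite (eq_sym (iopp j)) (eq_sym j) eq_oppl ij.
Qed.

Lemma opp_neqE (i : idx) : ((iopp i == i) = false) * ((i == iopp i) = false).
Proof. by rewrite (eq_sym i) (negPf (opp_neq i)). Qed.

Lemma boolRE : (false%:R = 0 :> R) * (true%:R = 1 :> R).
Proof. by []. Qed.

Lemma st_rel_elem u v : st_rel u v -> weval symbol_elem u = weval symbol_elem v.
Proof.
case=> {u v}.
- move=> i j a ij ji'; rewrite !weval_gen; apply/val_inj/SpP => w.
  apply/ffunP => m /=; have [ji|ji] := eqVneq j (iopp i).
    rewrite !elem_short ?ji ?oppK // ?eps_opp.
    by case: (epsP i) => ->; ring.
  rewrite !elem_long ?oppK ?(neq_oppE ji) // !eps_opp.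
  by case: (epsP i) => ->; case: (epsP j) => ->; ring.
- move=> i j a b ij; rewrite weval_cat !weval_gen; apply/val_inj/SpP => w.
  apply/ffunP => m /=; rewrite sp_mulE; have [ji|ji] := eqVneq j (iopp i).
    by rewrite !elem_short // ji opp_neqE boolRE; ring.
  rewrite !elem_long // !(neqE ij, neq_oppE ji, opp_neqE, boolRE); ring.
- move=> i j h k a b ij hk hj hi ki kj; rewrite weval_comm !weval_gen.
  rewrite [RHS]big_nil; apply: val_inj; apply: Sp_commE => w m.
  have [c [d Ec]] := elem_gen ij a; have [c' [d' Ec']] := elem_gen hk b.
  change (elem ij a (elem hk b w) m = elem hk b (elem ij a w) m).
  rewrite !Ec !Ec' !Ec.
  rewrite !(neqE hj, neq_oppE hi, neqE ki, neq_oppE kj, boolRE); ring.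
- move=> i j k a b ij jk ik ij' ik' jk'; rewrite weval_comm !weval_gen.
  apply: val_inj; apply: Sp_commE => w m.
  change (elem ij a (elem jk b w) m =
          elem ik (a * b) (elem jk b (elem ij a w)) m).
  rewrite !elem_long ?(neqE ij, neqE jk, neqE ik, neq_oppE ij', neq_oppE ik', neq_oppE jk', opp_neqE, eqxx, boolRE) //.
  by case: (epsP i) => ->; case: (epsP j) => ->; case: (epsP k) => ->; ring.
- move=> i j a b ii' i'j ij j'j.
  rewrite weval_comm weval_cat !weval_gen.
  apply: val_inj; apply: Sp_commE => w m.
  change (elem ii' a (elem i'j b w) m =
          elem ij (a * b * eps i) (elem j'j (- (a * b ^+ 2))
            (elem i'j b (elem ii' a w))) m).
  have ij' : i != iopp j by rewrite -eq_oppl.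
  rewrite !(elem_long i'j, elem_long ij, elem_short ii', elem_short j'j) ?oppK
    ?(neqE ij, neq_oppE ij', opp_neqE, eqxx, boolRE) //.
  by rewrite !eps_opp; case: (epsP i) => ->; case: (epsP j) => ->; ring.
- move=> i j a b ij ji' ii'.
  rewrite weval_comm !weval_gen.
  apply: val_inj; apply: Sp_commE => w m.
  change (elem ij a (elem ji' b w) m =
          elem ii' (2%:R * a * b * eps i) (elem ji' b (elem ij a w)) m).
  rewrite !(elem_long ji', elem_long ij, elem_short ii') ?oppK
    ?(neqE ij, neq_oppE ji', opp_neqE, eqxx, boolRE) //.
  by rewrite !eps_opp; case: (epsP i) => ->; case: (epsP j) => ->; ring.
Qed.

Definition phi : {multiplicative StSp -> Ep} := plift st_rel_elem.

Lemma phiE i j (ij : i != j) a : phi (x_ ij a) = Ep_elem ij a.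
Proof. by rewrite [LHS](plift_class st_rel_elem) weval_gen. Qed.

Definition K2Sp : set StSp := group_kernel phi.

End Symplectic.

Arguments StSp l R : clear implicits.
Arguments Ep l R : clear implicits.
Arguments phi l R : clear implicits.
Arguments K2Sp l R : clear implicits.

(* Main.v *)
From mathcomp Require Import all_boot all_algebra ring.
From mathcomp Require Import boolp classical_sets.
Require Import Defs.

Set Implicit Arguments.
Unset Strict Implicit.
Unset Printing Implicit Defensive.

Import GRing.Theory.

(** The proof extends the long root elements X_{i,-i}(a), which lift the
    transvections T(e_i, 0, a), to a lift of T(u, 0, a) for every vector u of V,
    unimodular or not, and shows that this lift is equivariant:
    [g (lift of T(u, 0, a)) g^-1 = lift of T(phi(g) u, 0, a)] for all g in the
    Steinberg group. An element g of the kernel of phi then commutes with all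
    these lifts. Those at u = e_i and at u = e_i + e_k recover X_{i,-i}(a) and
    the product of X_{i,-i}(a), a short root element and X_{k,-k}(a), so that g
    commutes with all generators.

    The hyperbolic plane spanned by e_i and e_{-i} is called the line of i, being
    numbered by the second component of i. The lift is built in three stages. If
    v has no component on the line of i, then T(e_i, v, a) lies in the unipotent
    radical of the stabilizer of e_i and has an evident lift [xrad i v a], a
    product of root elements. Conjugating the long root element at e_{-i} by
    [xrad i v 0] must produce a lift of T(e_{-i} + eps_i v, 0, a); dividing by a
    radical element at e_{-i} leaves a lift [tlong i v a] of T(v, 0, a). Finally,
    if u = h + v with h on the line of i and v off it, then
      T(u, 0, a) = T(h, 0, a) T(v, a h, 0) T(v, 0, a),
    where T(h, 0, a) is lifted through any other line, and T(v, a h, 0) through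
    the radicals at e_i and e_{-i} ([tplane]); this is [tfull].

    By construction [tfull i] is equivariant under the root elements that do
    not involve the line of i. As l >= 3, every root element avoids some line,
    so everything reduces to the independence of [tfull] of the line
    ([tfull_indep]). That in turn rests on the fact that [tlong i v a] does not
    depend on i when v vanishes on at least two lines ([tlong_change_line]), on
    the commutator formula [lconj_xrad_on], and on the symmetry [tplaneC], which
    is obtained by passing through a third line. *)

(** * Products up to commutation *)
Section Words.
Local Open Scope group_scope.
Variable G : groupType.
Implicit Types x y z p : G.

(** Left conjugation, unlike [conjg], to agree with the action on V. *)
Definition lconj g x : G := g * x * g^-1.

Lemma lconjM g x y : lconj g (x * y) = lconj g x * lconj g y.
Proof. by rewrite /lconj !mulgA mulgVK. Qed.

Lemma lconjV g x : lconj g x^-1 = (lconj g x)^-1.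
Proof. by rewrite /lconj !invgM invgK !mulgA. Qed.

Lemma lconj_lconj g h x : lconj (g * h) x = lconj g (lconj h x).
Proof. by rewrite /lconj !invgM !mulgA. Qed.

Lemma mulg_lconj g x : g * x = lconj g x * g.
Proof. by rewrite /lconj mulgVK. Qed.

Lemma lconj_eq g x y : g * x = y * g -> lconj g x = y.
Proof. by rewrite /lconj => ->; rewrite mulgK. Qed.

Lemma lconj_id g x : commute g x -> lconj g x = x.
Proof. exact: lconj_eq. Qed.

Lemma commute_lconj g x : lconj g x = x -> commute g x.
Proof. by move=> e; rewrite /commute mulg_lconj e. Qed.

Lemma commuteMl x y z : commute x z -> commute y z -> commute (x * y) z.
Proof. by move=> /commute_sym xz /commute_sym yz; apply/commute_sym/commuteM. Qed.

Lemma commuteVl x y : commute x y -> commute x^-1 y.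
Proof. by move=> /commute_sym xy; apply/commute_sym/commuteV. Qed.

Lemma commute_swapA x y z : commute x y -> x * (y * z) = y * (x * z).
Proof. by move=> xy; rewrite !mulgA xy. Qed.

Lemma commute_swap x y : commute x y -> x * y = y * x.
Proof. by []. Qed.

End Words.

Ltac solve_commute :=
  match goal with
  | H : commute ?a ?b |- commute ?a ?b => exact H
  | H : commute ?b ?a |- commute ?a ?b => exact (commute_sym H)
  | |- commute ?a ?a => exact (commute_refl a)
  | |- commute ?a (?b * ?c)%g => apply: (@commuteM _ a b c); solve_commute
  | |- commute (?b * ?c)%g ?a => apply: (@commuteMl _ b c a); solve_commute
  | |- commute ?a (?b^-1)%g => apply: (@commuteV _ a b); solve_commute
  | |- commute (?b^-1)%g ?a => apply: (@commuteVl _ b a); solve_commute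
  end.

Ltac bubble a :=
  repeat match goal with
  | |- _ = a => fail 1
  | |- _ = (a * _)%g => fail 1
  | |- context C [(?b * (a * ?t))%g] => rewrite (@commute_swapA _ b a t); [ | solve_commute]
  | |- context C [(?b * a)%g] =>
      rewrite (@commute_swap _ b a); [ | solve_commute]
  end.

(** Brings the first factor of the left-hand side to the front of the
    right-hand side and cancels it. *)
Ltac cancel_head :=
  match goal with
  | |- ?x = ?x => reflexivity
  | |- (?a * ?t)%g = ?rhs =>
     match goal with |- ?l = ?r =>
       let L := fresh "L" in set L := l;
       bubble a; subst L; congr (a * _)%g end
  end.
(** The factors are turned into variables first: comparing two different root
    elements by conversion would unfold their coefficients. *)
Ltac abstract_atom x :=
  match x with
  | (_ * _)%g => fail 1
  | (_^-1)%g => fail 1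
  | _ => assert_fails (is_var x); let z := fresh "z" in set (z := x) in *; clearbody z
  end.
Ltac abstract_atoms :=
  repeat match goal with z := _ |- _ => clearbody z end;
  repeat match goal with
  | |- context [(?x * _)%g] => abstract_atom x
  | |- context [(_ * ?x)%g] => abstract_atom x
  | |- context [(?x^-1)%g] => abstract_atom x
  end.
Ltac commute_eq := abstract_atoms; rewrite -?mulgA; repeat cancel_head.

(** * Long and short root elements of the Steinberg group *)
Section SteinbergRelations.
Variables (l : nat) (R : comPzRingType).
Local Notation idx := (idx l).
Local Notation V := (V l R).
Local Notation G := (StSp l R).
Local Notation eps := (eps R).
Local Notation ebas := (@ebas l R).
Implicit Types (i j k p q : idx) (a b c : R) (u v w : V) (g : G).

Local Open Scope ring_scope.

Lemma sqr_eps i : eps i * eps i = 1.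
Proof. by case: (epsP R i) => ->; rewrite ?mulrNN mulr1. Qed.

(** The generator X_{ij}(a), extended by 1 to i = j, to have no proof argument. *)
Definition St_root i j a : G :=
  if insub (i, j) is Some p then pclass (@st_rel l R) (wgen (p, a)) else 1%g.

Lemma St_rootE i j (ij : i != j) a : St_root i j a = x_ ij a.
Proof. by rewrite /St_root insubT. Qed.

Definition St_long i a : G := St_root i (iopp i) a.
(** With this sign convention [St_short i k c] lifts T(e_i, c e_k, 0), and the
    defining relations become the identities of transvections below. *)
Definition St_short i k c : G := St_root i (iopp k) (c * eps k).

(** The lines of i and j are distinct when the second components of i and j
    are; this says i <> j and i <> - j at once. *)
Lemma far_neq i j : i.2 != j.2 -> i != j.
Proof. by apply: contraNneq => ->. Qed.
Lemma far_opp i j : i.2 != j.2 -> i != iopp j.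
Proof. by apply: contraNneq => ->. Qed.
Lemma far_sym i j : i.2 != j.2 -> j.2 != i.2.
Proof. by rewrite eq_sym. Qed.
Lemma neq_opp i : i != iopp i.
Proof. by rewrite eq_sym opp_neq. Qed.
Hint Resolve neq_opp : core.

Lemma same_line i j : i.2 = j.2 -> j = i \/ j = iopp i.
Proof.
by case: i j => [b m] [b' m'] /= ->; case: b b' => -[]; [left|right|right|left].
Qed.

Lemma pclass_rel s t : st_rel s t -> pclass (@st_rel l R) s = pclass (@st_rel l R) t.
Proof. by move=> uv; apply/pclassP/PresRel. Qed.

Lemma pclass_comm s t r : st_rel (wcomm s t) r ->
  (pclass (@st_rel l R) s * pclass (@st_rel l R) t =
   pclass (@st_rel l R) r *
     (pclass (@st_rel l R) t * pclass (@st_rel l R) s) :> G)%g.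
Proof.
move=> /pclass_rel; rewrite /wcomm !pclassM !pclassV => e.
by rewrite -e !mulgA !mulgVK.
Qed.

Lemma St_root_sym i j a : i != j ->
  St_root i j a = St_root (iopp j) (iopp i) (- (a * eps i * eps j)).
Proof.
move=> ij; have ji' : iopp j != iopp i by rewrite eq_opp eq_sym.
by rewrite !St_rootE; apply: pclass_rel; exact: StR0.
Qed.

Lemma St_rootD i j a b : i != j ->
  St_root i j (a + b) = (St_root i j a * St_root i j b)%g.
Proof.
by move=> ij; rewrite !St_rootE /x_ -pclassM; apply/esym/pclass_rel; exact: StR1.
Qed.

Lemma St_root_comm i j h k a b : i != j -> h != k ->
  h != j -> h != iopp i -> k != i -> k != iopp j ->
  commute (St_root i j a) (St_root h k b).
Proof.
move=> ij hk hj hi ki kj; rewrite !St_rootE /commute.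
have /pclass_comm /= := StR2 a b ij hk hj hi ki kj.
by rewrite mul1g.
Qed.

Lemma St_root_R3 i j k a b : i != j -> j != k -> i != k ->
  i != iopp j -> i != iopp k -> j != iopp k ->
  (St_root i j a * St_root j k b = St_root i k (a * b) * (St_root j k b * St_root i j a))%g.
Proof.
move=> ij jk ik ij' ik' jk'; rewrite !St_rootE.
exact: pclass_comm (StR3 a b ij jk ik ij' ik' jk').
Qed.

Lemma St_root_R4 i j a b : iopp i != j -> i != j ->
  (St_root i (iopp i) a * St_root (iopp i) j b =
   St_root i j (a * b * eps i) * St_root (iopp j) j (- (a * b ^+ 2)) *
   (St_root (iopp i) j b * St_root i (iopp i) a))%g.
Proof.
move=> i'j ij; have jj := opp_neq j; rewrite !St_rootE.
by have /pclass_comm := StR4 a b (neq_opp i) i'j ij jj; rewrite pclassM.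
Qed.

Lemma St_root_R5 i j a b : i != j -> j != iopp i ->
  (St_root i j a * St_root j (iopp i) b =
   St_root i (iopp i) (2%:R * a * b * eps i) * (St_root j (iopp i) b * St_root i j a))%g.
Proof.
move=> ij ji'; rewrite !St_rootE.
exact: pclass_comm (StR5 a b ij ji' (neq_opp i)).
Qed.

Lemma St_shortC i k c : i.2 != k.2 -> St_short i k c = St_short k i c.
Proof.
move=> ik; rewrite /St_short St_root_sym ?far_opp // oppK; congr St_root.
by rewrite eps_opp; case: (epsP R i) (epsP R k) => -> [] ->; ring.
Qed.

Lemma St_shortD i k a b : i.2 != k.2 ->
  St_short i k (a + b) = (St_short i k a * St_short i k b)%g.
Proof. by move=> ik; rewrite /St_short mulrDl St_rootD ?far_opp. Qed.

Lemma St_longD i a b : St_long i (a + b) = (St_long i a * St_long i b)%g.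
Proof. by rewrite /St_long St_rootD. Qed.

Lemma St_long_comm i j a b : i != iopp j -> commute (St_long i a) (St_long j b).
Proof.
move=> ij; have [->|ne] := eqVneq i j.
  by rewrite /commute -!St_longD addrC.
have ji' : j != iopp i by rewrite eq_sym eq_oppl.
have j'i : iopp j != i by rewrite eq_sym.
by apply: St_root_comm; rewrite ?oppK.
Qed.

Lemma St_long_short_comm i p q a b : p.2 != q.2 -> p != iopp i -> q != iopp i ->
  commute (St_long i a) (St_short p q b).
Proof.
move=> pq pi qi; apply: St_root_comm => //; rewrite ?oppK ?eq_oppl //.
exact: far_opp.
Qed.

Lemma St_short_comm i k p q a b : i.2 != k.2 -> p.2 != q.2 ->
  p != iopp i -> p != iopp k -> q != iopp i -> q != iopp k ->
  commute (St_short i k a) (St_short p q b).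
Proof.
move=> ik pq pi pk qi qk; apply: St_root_comm => //; rewrite ?oppK ?eq_oppl //.
  exact: far_opp.
exact: far_opp.
Qed.

Lemma St_short_mul_short i k m a b : i.2 != k.2 -> k.2 != m.2 -> i.2 != m.2 ->
  (St_short i k a * St_short (iopp k) m b =
   St_short i m (a * b * eps k) * (St_short (iopp k) m b * St_short i k a))%g.
Proof.
move=> ik km im; rewrite /St_short St_root_R3 ?oppK ?far_opp ?far_neq ?eq_opp //.
by congr (St_root _ _ _ * _)%g; ring.
Qed.

Lemma St_short_mul_long i k a b : i.2 != k.2 ->
  (St_short i k a * St_short (iopp k) i b =
   St_long i (2%:R * a * b * eps k) * (St_short (iopp k) i b * St_short i k a))%g.
Proof.
move=> ik; rewrite /St_short /St_long St_root_R5 ?far_opp ?eq_opp //.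
- congr (St_root _ _ _ * _)%g; case: (epsP R i) => ->; ring.
- exact: far_sym.
Qed.

Lemma St_long_mul_short i k a b : i.2 != k.2 ->
  (St_long i a * St_short (iopp i) k b =
   St_short i k (a * b * eps i) * St_long k (- (a * b ^+ 2)) * (St_short (iopp i) k b * St_long i a))%g.
Proof.
move=> ik; rewrite /St_short /St_long St_root_R4 ?far_opp ?eq_opp ?far_neq //.
rewrite oppK; congr (St_root _ _ _ * St_root _ _ _ * _)%g; first by ring.
by rewrite exprMn (expr2 (eps k)) sqr_eps mulr1.
Qed.

(** Every generator X_{ij}(a) is a long root element (j = - i) or a short one. *)
Lemma St_ind (P : G -> Prop) :
  P 1%g -> (forall g h, P g -> P h -> P (g * h)%g) -> (forall g, P g -> P g^-1%g) ->
  (forall i a, P (St_long i a)) -> (forall i k a, i.2 != k.2 -> P (St_short i k a)) ->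
  forall g, P g.
Proof.
move=> P1 PM PV PS PY g; rewrite -[g]preprK; elim: (prepr g) => [|[[[[i j] /= ij] a] b] w IHw].
  exact: P1.
rewrite -cat1s pclassM; apply: PM => //.
have Px : P (x_ ij a).
  rewrite -St_rootE; have [ji|ji] := eqVneq j (iopp i); first by rewrite ji; exact: PS.
  have -> : St_root i j a = St_short i (iopp j) (a * eps (iopp j)).
    by rewrite /St_short oppK -mulrA sqr_eps mulr1.
  by apply: PY; apply: contraTneq ij => /= /same_line[->|e]; [rewrite eqxx | rewrite e eqxx in ji].
case: b => //.
by have /PV := Px; rewrite /x_ -pclassV.
Qed.

(** The Steinberg group acts on V through phi. *)
Definition St_act g v : V := sp_fun (val (phi l R g)) v.

Lemma St_act1 v : St_act 1%g v = v.
Proof. by rewrite /St_act gmulf1. Qed.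
Lemma St_actM g h v : St_act (g * h)%g v = St_act g (St_act h v).
Proof. by rewrite /St_act gmulfM. Qed.
Lemma St_act_sp g : [/\ linear (St_act g), bijective (St_act g)
  & forall u v, form (St_act g u) (St_act g v) = form u v].
Proof. by have /asboolP := valP (val (phi l R g)). Qed.

Lemma St_actD g u v : St_act g (u + v) = St_act g u + St_act g v.
Proof. by have [L _ _] := St_act_sp g; have := L 1 u v; rewrite !scale1r. Qed.
Lemma St_act0 g : St_act g 0 = 0.
Proof. by apply: (addrI (St_act g 0)); rewrite -St_actD !addr0. Qed.
Lemma St_actZ g c v : St_act g (c *: v) = c *: St_act g v.
Proof. by have [L _ _] := St_act_sp g; have := L c v 0; rewrite !addr0 St_act0 addr0. Qed.
Lemma St_act_form g u v : form (St_act g u) (St_act g v) = form u v.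
Proof. by have [_ _ ->] := St_act_sp g. Qed.

Lemma St_act_long i a v : St_act (St_long i a) v = transv (ebas i) 0 a v.
Proof.
rewrite /St_act /St_long St_rootE phiE /= [LHS]/(transv _ _ _ v) /Tvec /Tcoef eqxx //.
Qed.

Lemma St_act_short i k c v : i.2 != k.2 ->
  St_act (St_short i k c) v = transv (ebas i) (c *: ebas k) 0 v.
Proof.
move=> ik; have ne := far_opp ik; rewrite /St_act /St_short St_rootE phiE /=.
rewrite [LHS]/(transv _ _ _ v) /Tvec /Tcoef eq_opp (negPf (far_neq (far_sym ik))).
by rewrite oppK -mulrA sqr_eps mulr1.
Qed.

End SteinbergRelations.

(** * Root elements acting on V *)
Section Datum.
Local Open Scope ring_scope.
(** The rest of the argument takes place in a group with elements [xlong i a]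
    and [xshort i k c], subject to the Steinberg relations and acting on V as
    T(e_i, 0, a) and T(e_i, c e_k, 0). Working with such a group rather than with
    the quotient of the set of words keeps the elements of the group free of
    any inner structure. *)
Record steinberg (l : nat) (R : comPzRingType) := Steinberg {
  sG :> groupType;
  xlong : idx l -> R -> sG;
  xshort : idx l -> idx l -> R -> sG;
  act : sG -> V l R -> V l R;
  xshortC : forall i k c, i.2 != k.2 -> xshort i k c = xshort k i c;
  xshortD : forall i k a b, i.2 != k.2 -> xshort i k (a + b) = (xshort i k a * xshort i k b)%g;
  xlongD : forall i a b, xlong i (a + b) = (xlong i a * xlong i b)%g;
  xlong_comm : forall i j a b, i != iopp j -> commute (xlong i a) (xlong j b);
  xlong_short_comm : forall i p q a b, p.2 != q.2 -> p != iopp i -> q != iopp i ->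
    commute (xlong i a) (xshort p q b);
  xshort_comm : forall i k p q a b, i.2 != k.2 -> p.2 != q.2 ->
    p != iopp i -> p != iopp k -> q != iopp i -> q != iopp k ->
    commute (xshort i k a) (xshort p q b);
  xshort_mul_short : forall i k m a b, i.2 != k.2 -> k.2 != m.2 -> i.2 != m.2 ->
    (xshort i k a * xshort (iopp k) m b =
     xshort i m (a * b * eps R k) * (xshort (iopp k) m b * xshort i k a))%g;
  xshort_mul_long : forall i k a b, i.2 != k.2 ->
    (xshort i k a * xshort (iopp k) i b =
     xlong i (2%:R * a * b * eps R k) * (xshort (iopp k) i b * xshort i k a))%g;
  xlong_mul_short : forall i k a b, i.2 != k.2 ->
    (xlong i a * xshort (iopp i) k b =
     xshort i k (a * b * eps R i) * xlong k (- (a * b ^+ 2)) *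
       (xshort (iopp i) k b * xlong i a))%g;
  act1 : forall v, act 1%g v = v;
  actM : forall g h v, act (g * h)%g v = act g (act h v);
  actD : forall g u v, act g (u + v) = act g u + act g v;
  actZ : forall g c v, act g (c *: v) = c *: act g v;
  act_form : forall g u v, form (act g u) (act g v) = form u v;
  act_xlong : forall i a v, act (xlong i a) v = transv (ebas R i) 0 a v;
  act_xshort : forall i k c v, i.2 != k.2 ->
    act (xshort i k c) v = transv (ebas R i) (c *: ebas R k) 0 v }.

Definition StSp_datum (l : nat) (R : comPzRingType) : steinberg l R :=
  @Steinberg l R (StSp l R) (@St_long l R) (@St_short l R) (@St_act l R)
    (@St_shortC l R) (@St_shortD l R) (@St_longD l R) (@St_long_comm l R) (@St_long_short_comm l R) (@St_short_comm l R)
    (@St_short_mul_short l R) (@St_short_mul_long l R) (@St_long_mul_short l R) (@St_act1 l R) (@St_actM l R)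
    (@St_actD l R) (@St_actZ l R) (@St_act_form l R) (@St_act_long l R) (@St_act_short l R).
End Datum.
Arguments xshortC {l R s} [i k] c _.
Arguments xshortD {l R s} [i k] a b _.
Arguments xlongD {l R s} i a b.
Arguments xlong_comm {l R s} [i j] a b _.
Arguments xlong_short_comm {l R s} [i p q] a b _ _ _.
Arguments xshort_comm {l R s} [i k p q] a b _ _ _ _ _ _.
Arguments xshort_mul_short {l R s} [i k m] a b _ _ _.
Arguments xshort_mul_long {l R s} [i k] a b _.
Arguments xlong_mul_short {l R s} [i k] a b _.
Arguments act1 {l R s} v.
Arguments actM {l R s} g h v.
Arguments actD {l R s} g u v.
Arguments actZ {l R s} g c v.
Arguments act_form {l R s} g u v.
Arguments act_xlong {l R s} i a v.
Arguments act_xshort {l R s} [i k] c v _.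

(** * Vectors off a line *)
Section TransvectionLifts.
Variables (l : nat) (R : comPzRingType) (T : steinberg l R).
Local Notation idx := (idx l).
Local Notation V := (V l R).
Local Notation G := (sG T).
Local Notation eps := (eps R).
Local Notation ebas := (@ebas l R).
Local Notation xshort := (@xshort l R T).
Local Notation xlong := (@xlong l R T).
Local Notation act := (@act l R T).
Implicit Types (i j k p q : idx) (a b c : R) (h u v w : V) (g : G).
Local Open Scope ring_scope.

Lemma xlong0 i : xlong i 0 = 1%g.
Proof. by apply: (@mulgI _ (xlong i 0)); rewrite -xlongD addr0 mulg1. Qed.

Lemma xshort0 i k : i.2 != k.2 -> xshort i k 0 = 1%g.
Proof. by move=> ik; apply: (@mulgI _ (xshort i k 0)); rewrite -xshortD // addr0 mulg1. Qed.

Lemma act0 g : act g 0 = 0.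
Proof. by rewrite -[in RHS](scale0r (act g 0)) -actZ scale0r. Qed.

Lemma actK g v : act g^-1%g (act g v) = v.
Proof. by rewrite -actM mulVg act1. Qed.

Lemma actVK g v : act g (act g^-1%g v) = v.
Proof. by rewrite -actM mulgV act1. Qed.

(** The vectors off the line of i are those orthogonal to e_i and e_{-i}
    ([offP]); the parameters v of the unipotent radical at e_i are taken among
    them. *)
Definition off i v := v i = 0 /\ v (iopp i) = 0.

Lemma coordZ c v k : (c *: v) k = c * v k.
Proof. by rewrite ffunE. Qed.

Lemma offC i v : off i v -> off (iopp i) v.
Proof. by case=> a b; split; rewrite ?oppK. Qed.

Lemma off_opp i v : off (iopp i) v -> off i v.
Proof. by move/offC; rewrite oppK. Qed.

Lemma offE i v k : off i v -> k.2 = i.2 -> v k = 0.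
Proof. by case=> vi vi' /esym /same_line [] ->. Qed.

Lemma offD i u v : off i u -> off i v -> off i (u + v).
Proof. by move=> [a b] [c d]; split; rewrite !ffunE ?a ?b ?c ?d addr0. Qed.

Lemma offZ i c v : off i v -> off i (c *: v).
Proof. by move=> [a b]; split; rewrite !ffunE /GRing.scale /= ?a ?b mulr0. Qed.

Lemma off0 i : off i 0.
Proof. by split; rewrite ffunE. Qed.

Lemma offN i v : off i v -> off i (- v).
Proof. by rewrite -scaleN1r; exact: offZ. Qed.

Lemma off_ebas i k : i.2 != k.2 -> off i (ebas k).
Proof.
move=> ik; split; rewrite ffunE; first by rewrite (negPf (far_neq ik)).
by rewrite eq_oppl (negPf (far_opp ik)).
Qed.

Lemma form_eE i v : form (ebas i) v = eps i * v (iopp i).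
Proof. exact: form_e_l. Qed.

Lemma offP i v : off i v <-> form (ebas i) v = 0 /\ form (ebas (iopp i)) v = 0.
Proof.
rewrite !form_eE oppK eps_opp; split.
  by case=> -> ->; rewrite !mulr0.
case=> a b; split.
  by rewrite -[LHS]mul1r -(sqr_eps R i) -[eps i * eps i]mulrNN -mulrA b mulr0.
by rewrite -[LHS]mul1r -(sqr_eps R i) -mulrA a mulr0.
Qed.

Lemma formC0 u v : form u v = 0 -> form v u = 0.
Proof. by move=> e; rewrite form_anti e oppr0. Qed.

Lemma form0l v : form (0 : V) v = 0.
Proof. by have := formZl 0 0 v; rewrite scale0r mul0r. Qed.
Lemma form0r v : form v (0 : V) = 0.
Proof. by rewrite form_anti form0l oppr0. Qed.
Lemma formNl u v : form (- u) v = - form u v.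
Proof. by rewrite -scaleN1r formZl mulN1r. Qed.
Lemma formNr u v : form u (- v) = - form u v.
Proof. by rewrite -scaleN1r formZr mulN1r. Qed.

Lemma form_lines v w : form v w =
  \sum_(n < l) (v (true, n) * w (false, n) - v (false, n) * w (true, n)).
Proof.
rewrite /form (eq_bigr (fun i : idx => (fun (s : bool) (n : 'I_l) => eps (s, n) * v (s, n) * w (~~ s, n)) i.1 i.2)); last by case.
rewrite -(pair_bigA _ (fun (s : bool) (n : 'I_l) => eps (s, n) * v (s, n) * w (~~ s, n))) /=.
rewrite big_bool /= -big_split; apply: eq_bigr => n _ /=.
by rewrite /Defs.eps /=; ring.
Qed.

(** * The unipotent radical of the stabilizer of a basis vector *)

(** The lift of T(e_i, x e_n + y e_{-n}, 0): the two short root elements multiply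
    to T(e_i, x e_n + y e_{-n}, x y), which the long root element corrects. *)
Definition line_factor i v (n : 'I_l) : G :=
  (xshort i (true, n) (v (true, n)) * xshort i (false, n) (v (false, n)) *
   xlong i (- (v (true, n) * v (false, n))))%g.

Definition lines i := [seq n <- enum 'I_l | n != i.2].

(** The lift of T(e_i, v, a), for v off the line of i. It is locked so
    that unification compares its parameters and not its expansion. *)
Definition xrad i v a : G := locked ((\prod_(n <- lines i) line_factor i v n) * xlong i a)%g.

Lemma lines_far i n : n \in lines i -> i.2 != n.
Proof. by rewrite mem_filter eq_sym => /andP[]. Qed.

Lemma lines_uniq i : uniq (lines i).
Proof. by rewrite filter_uniq // enum_uniq. Qed.

Lemma xlong_line_factor_comm i v n a : i.2 != n ->
  commute (xlong i a) (line_factor i v n).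
Proof.
move=> ne; rewrite /line_factor; apply: commuteM; last by apply: xlong_comm; exact: neq_opp.
by apply: commuteM; apply: xlong_short_comm => //; rewrite ?neq_opp ?far_opp // eq_sym.
Qed.

Lemma line_factor_comm i v w m n : i.2 != n -> i.2 != m -> m != n ->
  commute (line_factor i v m) (line_factor i w n).
Proof.
move=> ni mi mn.
have YY (b b' : bool) x y : commute (xshort i (b, m) x) (xshort i (b', n) y).
  apply: xshort_comm => //; [exact: neq_opp | exact: (@far_opp _ i (b, m)) | | ].
    by apply: far_opp; rewrite eq_sym.
  by apply: (@far_opp _ (b', n) (b, m)); rewrite eq_sym.
have SS x y : commute (xlong i x) (xlong i y) by apply: xlong_comm; exact: neq_opp.
have SY (b : bool) (z : 'I_l) x y : i.2 != z -> commute (xlong i x) (xshort i (b, z) y).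
  by move=> iz; apply: xlong_short_comm => //; [exact: neq_opp | apply: far_opp; rewrite eq_sym].
rewrite /line_factor; set x1 := xshort _ _ _; set x2 := xshort _ _ _; set x3 := xlong _ _.
set y1 := xshort _ _ _; set y2 := xshort _ _ _; set y3 := xlong _ _.
have d1 : commute x3 y1 by exact: SY.
have d2 : commute x3 y2 by exact: SY.
have d3 : commute y3 x1 by exact: SY.
have d4 : commute y3 x2 by exact: SY.
have d5 : commute x3 y3 by exact: SS.
have d6 : commute x1 y1 by exact: YY.
have d7 : commute x1 y2 by exact: YY.
have d8 : commute x2 y1 by exact: YY.
have d9 : commute x2 y2 by exact: YY.
solve_commute.
Qed.

Lemma line_factorD i v w n : i.2 != n ->
  (line_factor i v n * line_factor i w n =
   line_factor i (v + w) n * xlong i (v (true, n) * w (false, n) - v (false, n) * w (true, n)))%g.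
Proof.
move=> ni; pose t : idx := (true, n); pose f : idx := (false, n).
have it : i.2 != t.2 by []. have if' : i.2 != f.2 by [].
rewrite /line_factor -/t -/f !ffunE.
have SS x y : commute (xlong i x) (xlong i y) by apply: xlong_comm; exact: neq_opp.
have SY k x y : i.2 != k.2 -> commute (xlong i x) (xshort i k y).
  by move=> ik; apply: xlong_short_comm => //; [exact: neq_opp | apply: far_opp; rewrite eq_sym].
have swap : (xshort i f (v f) * xshort i t (w t) = xlong i (- (2%:R * v f * w t)) * (xshort i t (w t) * xshort i f (v f)))%g.
  have := xshort_mul_long (s := T) (v f) (w t) if'; rewrite (@xshortC _ _ T (iopp f) i) 1?eq_sym // -[iopp f]/t.
  by move=> ->; congr (xlong i _ * _)%g; rewrite /Defs.eps /=; ring.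
set s1 := xlong i (- (v t * v f)); set s2 := xlong i (- (w t * w f)).
have c1 : commute s1 (xshort i t (w t)) by exact: SY.
have c2 : commute s1 (xshort i f (w f)) by exact: SY.
set s3 := xlong i (- (2%:R * v f * w t)) in swap.
have c3 : commute s3 (xshort i t (w t)) by exact: SY.
have c4 : commute s3 (xshort i f (v f)) by exact: SY.
have c5 : commute s3 (xshort i f (w f)) by exact: SY.
have c6 : commute s1 s2 by exact: SS.
have c7 : commute s3 s2 by exact: SS.
have c8 : commute s3 s1 by exact: SS.
have c9 : commute s3 (xshort i t (v t)) by exact: SY.
transitivity (xshort i t (v t) * (xshort i f (v f) * xshort i t (w t)) * xshort i f (w f) * s1 * s2)%g.
  by commute_eq.
rewrite swap.
transitivity (xshort i t (v t) * xshort i t (w t) * (xshort i f (v f) * xshort i f (w f)) * (s1 * s2 * s3))%g.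
  by commute_eq.
rewrite -!xshortD // -[RHS]mulgA /s1 /s2 /s3 -!xlongD; congr (_ * xlong i _)%g; ring.
Qed.

(** Factors on different lines commute, so the defects of additivity of the
    single lines add up. *)
Lemma prod_line_factorD i v w s : uniq s -> (forall n, n \in s -> i.2 != n) ->
  ((\prod_(n <- s) line_factor i v n) * (\prod_(n <- s) line_factor i w n) =
   (\prod_(n <- s) line_factor i (v + w)%R n) *
     xlong i (\sum_(n <- s) (v (true, n) * w (false, n) - v (false, n) * w (true, n))))%g.
Proof.
elim: s => [|n s IHs] /=; first by rewrite !big_nil xlong0 mulg1.
case/andP=> ns us fs; rewrite !big_cons.
have IH := IHs us (fun m ms => fs m (@mem_behead _ (n :: s) m ms)).
have ni : i.2 != n by apply: fs; exact: mem_head.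
have c1 u u' : commute (line_factor i u n) (\prod_(n <- s) line_factor i u' n)%g.
  rewrite big_seq; apply: commute_prod => m ms; apply: line_factor_comm => //.
    by apply: fs; rewrite in_cons ms orbT.
  by apply: contraNneq ns => ->.
have c2 a u : commute (xlong i a) (\prod_(n <- s) line_factor i u n)%g.
  rewrite big_seq; apply: commute_prod => m ms; apply: xlong_line_factor_comm.
  by apply: fs; rewrite in_cons ms orbT.
have d1 := c1 w v.
move: (line_factorD v w ni) (c2 (v (true, n) * w (false, n) - v (false, n) * w (true, n)) (v + w)) d1 IH.
rewrite (xlongD i (_ - _)).
set bv := line_factor i v n; set bw := line_factor i w n; set bvw := line_factor i _ n.
set Pv := bigop _ _ (fun n => BigBody _ _ _ (line_factor i v n)).
set Pw := bigop _ _ (fun n => BigBody _ _ _ (line_factor i w n)).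
set Pvw := bigop _ _ (fun n => BigBody _ _ _ (line_factor i (v + w) n)).
set s1 := xlong i _; set s2 := xlong i _ => eb d2 d1 IH.
transitivity ((bv * bw) * (Pv * Pw))%g; first by commute_eq.
by rewrite eb IH; commute_eq.
Qed.

Lemma xlong_xrad_comm i a v c : commute (xlong i c) (xrad i v a).
Proof.
rewrite /xrad -lock; apply: commuteM; last by apply: xlong_comm; exact: neq_opp.
rewrite big_seq; apply: commute_prod => m ms; apply: xlong_line_factor_comm; exact: lines_far ms.
Qed.

(** The radical is a Heisenberg group. *)
Lemma xradM i v w a b : off i v ->
  (xrad i v a * xrad i w b = xrad i (v + w) (a + b + form v w))%g.
Proof.
move=> ov; rewrite /xrad -!lock -mulgA (mulgA (xlong i a)).
have -> : (xlong i a * \prod_(n <- lines i) line_factor i w n =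
           (\prod_(n <- lines i) line_factor i w n) * xlong i a)%g.
  rewrite big_seq; apply: commute_prod => m ms; apply: xlong_line_factor_comm; exact: lines_far ms.
rewrite -(mulgA _ (xlong i a)) mulgA prod_line_factorD ?lines_uniq //; last exact: lines_far.
rewrite -!mulgA -!xlongD; congr (_ * xlong i _)%g; rewrite addrC; congr (_ + _).
rewrite form_lines /lines big_filter big_enum_cond /= [RHS](bigID (fun n => n != i.2)) /=.
rewrite [X in _ = _ + X]big1 ?addr0 // => n; rewrite negbK => /eqP ->.
by rewrite !(offE ov) // !mul0r subr0.
Qed.

Lemma xrad0 i a : xrad i 0 a = xlong i a.
Proof.
rewrite /xrad -lock big_seq big1 ?mul1g // => n /lines_far ni.
by rewrite /line_factor !ffunE !xshort0 // mulr0 oppr0 xlong0 !mulg1.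
Qed.

Lemma xrad_ebas i k c : i.2 != k.2 -> xrad i (c *: ebas k) 0 = xshort i k c.
Proof.
move=> ik; rewrite /xrad -lock xlong0 mulg1.
have kl : k.2 \in lines i by rewrite mem_filter eq_sym ik mem_enum.
have b1 n : i.2 != n -> n != k.2 -> line_factor i (c *: ebas k) n = 1%g.
  move=> ni nk; rewrite /line_factor !ffunE /GRing.scale /=.
  have ne (b : bool) : ((b, n) == k) = false by apply: contraNF nk => /eqP <-.
  by rewrite !ne !mulr0 oppr0 !xshort0 // xlong0 !mulg1.
have b2 : line_factor i (c *: ebas k) k.2 = xshort i k c.
  rewrite /line_factor !ffunE /GRing.scale /=; case: k ik {kl b1} => [] [] n /= ik;
  by rewrite -!pair_eqE /= !eqxx /= !mulr1 ?mulr0 ?mul0r oppr0 !xshort0 // xlong0 ?mulg1 ?mul1g.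
elim: (lines i) kl (lines_uniq i) (@lines_far i) => [|n s IHs] //= kl /andP[ns us] fs.
rewrite big_cons; have [e|ne] := eqVneq n k.2.
  rewrite e b2 big_seq big1 ?mulg1 // => m ms; apply: b1.
    by apply: fs; rewrite in_cons ms orbT.
  by apply: contraNneq ns => e'; rewrite e -e'.
rewrite b1 ?mul1g //; last by apply: fs; exact: mem_head.
apply: IHs => //; first by move: kl; rewrite in_cons eq_sym (negPf ne).
by move=> m ms; apply: fs; rewrite in_cons ms orbT.
Qed.

Lemma xradV i v a : off i v -> (xrad i v a)^-1%g = xrad i (- v) (- a).
Proof.
move=> ov; apply: (@mulgI _ (xrad i v a)); rewrite mulgV xradM //.
by rewrite formNr form_alt oppr0 addr0 !subrr xrad0 xlong0.
Qed.

Lemma xradM_orth i v w a b : off i v -> form v w = 0 ->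
  (xrad i v a * xrad i w b = xrad i (v + w) (a + b))%g.
Proof. by move=> ov vw; rewrite xradM // vw addr0. Qed.

Lemma xradD i v w : off i v -> form v w = 0 ->
  xrad i (v + w) 0 = (xrad i v 0 * xrad i w 0)%g.
Proof. by move=> ov vw; rewrite xradM_orth // addr0. Qed.

Lemma xrad_comm i v w a b : off i v -> off i w -> form v w = 0 ->
  commute (xrad i v a) (xrad i w b).
Proof.
move=> ov ow vw; rewrite /commute !xradM_orth //; last exact: formC0.
by rewrite addrC (addrC a).
Qed.

Lemma xrad_split i v a : off i v -> xrad i v a = (xrad i v 0 * xlong i a)%g.
Proof. by move=> ov; rewrite -xrad0 xradM_orth ?form0r // addr0 add0r. Qed.

Lemma xrad_ebasC i k c : i.2 != k.2 -> xrad i (c *: ebas k) 0 = xrad k (c *: ebas i) 0.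
Proof. by move=> ik; rewrite xrad_ebas // xrad_ebas 1?eq_sym //; exact: xshortC. Qed.

Lemma vec_sum v : v = \sum_k v k *: ebas k.
Proof.
apply/ffunP => m; rewrite sum_ffunE (bigD1 m) //= big1 ?addr0.
  by rewrite !ffunE eqxx /GRing.scale /= mulr1.
by move=> k /negPf km; rewrite !ffunE eq_sym km /GRing.scale /= mulr0.
Qed.

(** By [xradM] the radical is generated by root elements; a property of the
    triples (v, a, lift of T(e_i, v, a)) that is compatible with products need
    only be checked on these. *)
Lemma xrad_ind i (P : V -> R -> G -> Prop) v : off i v ->
  (forall a, P 0 a (xlong i a)) ->
  (forall k, i.2 != k.2 -> P (v k *: ebas k) 0 (xshort i k (v k))) ->
  (forall u w a b g g', off i u -> off i w -> P u a g -> P w b g' ->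
    P (u + w) (a + b + form u w) (g * g')%g) ->
  forall a, P v a (xrad i v a).
Proof.
move=> ov PS PY PM a.
suff H s b : off i (\sum_(k <- s) v k *: ebas k) /\
   P (\sum_(k <- s) v k *: ebas k) b (xrad i (\sum_(k <- s) v k *: ebas k) b).
  by have [_] := H (index_enum idx) a; rewrite -vec_sum.
elim: s b => [|k s IHs] b.
  by rewrite !big_nil xrad0; split; [exact: off0 | exact: PS].
rewrite !big_cons; have [ik|ik] := eqVneq i.2 k.2.
  by rewrite (offE ov (esym ik)) scale0r !add0r; exact: IHs.
set u := _ *: _; set w := \sum_(k <- s) _.
have ou : off i u by apply: offZ; exact: off_ebas.
have [ow Pw] := IHs (b - form u w).
split; first exact: offD.
have -> : b = 0 + (b - form u w) + form u w by ring.
rewrite -xradM //; apply: PM => //.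
by rewrite xrad_ebas //; exact: PY.
Qed.

Lemma form_far p i : p.2 != i.2 -> form (ebas p) (ebas i) = 0.
Proof. by move=> pi; have /offP[] := off_ebas pi. Qed.

Lemma off_form i v : off i v -> form (ebas i) v = 0.
Proof. by case/offP. Qed.

Lemma off_form' i v : off i v -> form v (ebas i) = 0.
Proof. by move/off_form/formC0. Qed.

Lemma transvE u v a w :
  transv u v a w = w + (form v w + a * form u w) *: u + form u w *: v.
Proof. by []. Qed.

Lemma transv_id u v a w : form u w = 0 -> form v w = 0 -> transv u v a w = w.
Proof. by move=> e1 e2; rewrite transvE e1 e2 mulr0 addr0 !scale0r !addr0. Qed.

(** * Elements acting on a radical through the symplectic group *)

(** The elements that fix e_i and e_{-i} and act on the lifts of the two
    radicals at e_i and e_{-i} the way their images act on V: a substitute for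
    the Levi subgroup, which is generated by the root elements that do not
    involve the line of i. *)
Definition levi i g := [/\ act g (ebas i) = ebas i, act g (ebas (iopp i)) = ebas (iopp i),
  forall v a, off i v -> (g * xrad i v a = xrad i (act g v) a * g)%g
  & forall v a, off i v -> (g * xrad (iopp i) v a = xrad (iopp i) (act g v) a * g)%g].

Lemma act_off i g v : act g (ebas i) = ebas i ->
  act g (ebas (iopp i)) = ebas (iopp i) ->
  off i v -> off i (act g v).
Proof.
move=> gi gi' /offP[e1 e2]; apply/offP.
by split; [rewrite -gi act_form | rewrite -gi' act_form].
Qed.

Lemma levi_off i g v : levi i g -> off i v -> off i (act g v).
Proof. by case=> gi gi' _ _; exact: act_off. Qed.

Lemma levi_opp i g : levi i g -> levi (iopp i) g.
Proof.
case=> gi gi' gE1 gE2; split=> // [|v a /off_opp ov|v a /off_opp ov]; rewrite ?oppK //.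
- exact: gE2.
- exact: gE1.
Qed.

Lemma leviM i g g' : levi i g -> levi i g' -> levi i (g * g')%g.
Proof.
move=> Lg Lh; have [gi gi' gE1 gE2] := Lg; have [hi hi' hE1 hE2] := Lh.
split; rewrite ?actM ?hi ?hi' // => v a ov; have ov' := levi_off Lh ov.
- by rewrite -mulgA hE1 // mulgA gE1 // -mulgA actM.
- by rewrite -mulgA hE2 // mulgA gE2 // -mulgA actM.
Qed.

Lemma leviV i g : levi i g -> levi i (g^-1)%g.
Proof.
move=> Lg; have [gi gi' gE1 gE2] := Lg.
have vi : act g^-1%g (ebas i) = ebas i by rewrite -{1}gi actK.
have vi' : act g^-1%g (ebas (iopp i)) = ebas (iopp i) by rewrite -{1}gi' actK.
have key (j : idx) : (forall v a, off i v -> (g * xrad j v a = xrad j (act g v) a * g)%g) ->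
   forall v a, off i v -> (g^-1 * xrad j v a = xrad j (act g^-1%g v) a * g^-1)%g.
  move=> H v a ov; have ov' := act_off vi vi' ov.
  apply: (@mulgI _ g); apply: (@mulIg _ g).
  by rewrite mulVKg -!mulgA mulVg mulg1 H // actVK.
by split=> //; exact: key.
Qed.

(** As both sides of the defining identity are multiplicative, it suffices to
    check it on root elements. *)
Lemma levi_half i g :
  act g (ebas i) = ebas i -> act g (ebas (iopp i)) = ebas (iopp i) ->
  (forall a, commute g (xlong i a)) ->
  (forall k c, i.2 != k.2 -> (g * xshort i k c = xrad i (act g (c *: ebas k)) 0 * g)%g) ->
  forall v a, off i v -> (g * xrad i v a = xrad i (act g v) a * g)%g.
Proof.
move=> gi gi' HS HY v a ov.
apply: (xrad_ind (P := fun v a x => (g * x = xrad i (act g v) a * g)%g)) => //.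
- by move=> b; rewrite act0 xrad0; exact: HS.
- by move=> k ik; exact: HY.
move=> u w b c x y ou ow ex ey.
rewrite mulgA ex -mulgA ey mulgA xradM; last exact: act_off.
by rewrite actD act_form.
Qed.

(** The only root element of the radical at e_i that does not commute with
    X_{p,-p} is the one that involves e_{-p}; this case is the relation R4. *)
Lemma levi_xlong i p c : i.2 != p.2 -> levi i (xlong p c).
Proof.
move=> ip; have pi : p.2 != i.2 by rewrite eq_sym.
have fx j : j.2 = i.2 -> act (xlong p c) (ebas j) = ebas j.
  by move=> ji; rewrite act_xlong transv_id ?form0l // form_far // ji.
have [fi fi'] := (fx i erefl, fx (iopp i) erefl).
suff key j : j.2 = i.2 -> forall v a, off j v -> (xlong p c * xrad j v a = xrad j (act (xlong p c) v) a * xlong p c)%g.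
  split=> //; first exact: key.
  by move=> v a /offC; exact: key.
move=> ji; have jp : j.2 != p.2 by rewrite ji.
have pj : p.2 != j.2 by rewrite ji.
apply: levi_half => [||a|k b jk]; rewrite ?fx //.
  by apply: xlong_comm; exact: far_opp.
rewrite act_xlong; have [e|ne] := eqVneq k (iopp p).
  rewrite {k}e in jk *; rewrite [xshort j _ _]xshortC // xlong_mul_short // transvE form0l add0r formZr form_e oppK eqxx mulr1 scaler0 addr0.
  have o1 : off j (ebas (iopp p)) by exact: off_ebas.
  have o2 : off j (ebas p) by exact: off_ebas.
  have f1 : form (ebas p) (ebas (iopp p)) = eps p by rewrite form_e oppK eqxx mulr1.
  have -> : xrad j (b *: ebas (iopp p) + c * (b * eps p) *: ebas p) 0 =
    (xrad j (c * (b * eps p) *: ebas p) 0 * xrad j (b *: ebas (iopp p)) 0 * xlong j (- (c * b ^+ 2)))%g.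
    rewrite -[xlong j _]xrad0 !xradM; try by do ?[apply: offD|apply: offZ].
    rewrite !formZl !formZr f1 form0r addr0 [b *: _ + _]addrC; congr xrad.
    by case: (epsP R p) => ->; ring.
  rewrite xrad_ebas // xrad_ebas // [xshort p j _]xshortC // [xshort (iopp p) j _]xshortC // mulrA -!mulgA; congr (_ * _)%g.
  have d1 : commute (xlong j (- (c * b ^+ 2))) (xshort j (iopp p) b).
    apply: xlong_short_comm => //; first exact: neq_opp.
    exact: far_opp.
  have d2 : commute (xlong j (- (c * b ^+ 2))) (xlong p c) by apply: xlong_comm; exact: far_opp.
  by commute_eq.
rewrite transv_id ?form0l //; last first.
  by rewrite formZr form_e -eq_oppl eq_sym (negPf ne) !mulr0.
rewrite xrad_ebas //; apply: xlong_short_comm => //; by apply: far_opp.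
Qed.

(** Here the relation R3 gives the two nontrivial cases, which are exchanged by
    the symmetry of short root elements. *)
Lemma levi_xshort i p q c : i.2 != p.2 -> i.2 != q.2 -> p.2 != q.2 ->
  levi i (xshort p q c).
Proof.
move=> ip iq pq.
have fx j : j.2 = i.2 -> act (xshort p q c) (ebas j) = ebas j.
  by move=> ji; rewrite act_xshort // transv_id ?formZl ?form_far ?mulr0 // ji eq_sym.
have [fi fi'] := (fx i erefl, fx (iopp i) erefl).
suff key j : j.2 = i.2 -> forall v a, off j v -> (xshort p q c * xrad j v a = xrad j (act (xshort p q c) v) a * xshort p q c)%g.
  split=> //; first exact: key.
  by move=> v a /offC; exact: key.
move=> ji; have jp : j.2 != p.2 by rewrite ji.
have jq : j.2 != q.2 by rewrite ji.
have pj : p.2 != j.2 by rewrite eq_sym.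
have qj : q.2 != j.2 by rewrite eq_sym.
apply: levi_half => [||a|k b jk]; rewrite ?fx //.
  by apply/commute_sym/xlong_short_comm => //; exact: far_opp.
have key p' q' : j.2 != p'.2 -> j.2 != q'.2 -> p'.2 != q'.2 -> k = iopp q' ->
   (xshort p' q' c * xshort j k b = xrad j (act (xshort p' q' c) (b *: ebas k)) 0 * xshort p' q' c)%g.
  move=> {}jp {}jq {}pq e; rewrite {k}e in jk *.
  have qp : q'.2 != p'.2 by rewrite eq_sym.
  have {}pj : p'.2 != j.2 by rewrite eq_sym.
  have {}qj : q'.2 != j.2 by rewrite eq_sym.
  rewrite act_xshort // transvE !formZl !formZr form_e oppK eqxx mulr1.
  rewrite (@form_far p' (iopp q')) // !mulr0 addr0 scale0r addr0.
  rewrite [xshort j _ _]xshortC // xshort_mul_short // xradD ?formZl ?formZr ?(@form_far (iopp q') p') ?mulr0 //; last first.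
    exact/offZ/off_ebas.
  have d1 : commute (xrad j (b *: ebas (iopp q')) 0) (xrad j (c * (b * eps q') *: ebas p') 0).
    by apply: xrad_comm; rewrite ?formZl ?formZr ?(@form_far (iopp q') p') ?mulr0 //; exact/offZ/off_ebas.
  by rewrite d1 xrad_ebas // xrad_ebas // [xshort p' _ _]xshortC // [xshort (iopp q') _ _]xshortC // mulrA -mulgA.
have [e|ne] := eqVneq k (iopp q); first exact: key.
have [e|ne'] := eqVneq k (iopp p).
  by rewrite xshortC //; apply: key => //; rewrite eq_sym.
rewrite act_xshort // transv_id.
- rewrite xrad_ebas //; apply: xshort_comm => //; try exact: far_opp.
- by rewrite formZr form_e -eq_oppl eq_sym (negPf ne') !mulr0.
- by rewrite formZl formZr form_e -eq_oppl eq_sym (negPf ne) !mulr0.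
Qed.

Lemma levi1 i : levi i 1%g.
Proof. by split; rewrite ?act1 // => v a _; rewrite mul1g mulg1 act1. Qed.

Lemma levi_xrad i p w b : i.2 != p.2 -> off i w -> off p w -> levi i (xrad p w b).
Proof.
move=> ip oi op.
apply: (xrad_ind (P := fun v a x => levi i x)) => //.
- by move=> a; exact: levi_xlong.
- move=> k pk; have [ik|ik] := eqVneq k.2 i.2.
    by rewrite (offE oi ik) xshort0 //; exact: levi1.
  by apply: levi_xshort => //; rewrite eq_sym.
- by move=> u v a c x y _ _; exact: leviM.
Qed.

Lemma act_xrad i v a w : off i v -> act (xrad i v a) w = transv (ebas i) v a w.
Proof.
move=> ov; move: w.
apply: (xrad_ind (P := fun v a x => forall w, act x w = transv (ebas i) v a w)) => //.
- by move=> b w; exact: act_xlong.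
- by move=> k ik w; exact: act_xshort.
move=> u u' b c x y ou ou' eg eh w; rewrite actM eh eg !transvE.
rewrite !formDr !formZr !formDl form_alt (off_form ou') (off_form' ou) mulr0 !addr0.
by apply/ffunP => m; rewrite !ffunE /GRing.scale /=; ring.
Qed.

Lemma xrad_mul_xrad i j w b v a : i.2 != j.2 -> off i w -> off j w -> off j v ->
  (xrad i w b * xrad j v a = xrad j (transv (ebas i) w b v) a * xrad i w b)%g.
Proof.
move=> ij oi oj ov; have ji : j.2 != i.2 by rewrite eq_sym.
by have [_ _ -> //] := levi_xrad b ji oj oi; rewrite act_xrad.
Qed.

Lemma levi_mul_xrad i g v a : levi i g -> off i v ->
  (g * xrad i v a = xrad i (act g v) a * g)%g.
Proof. by case=> _ _ H _; exact: H. Qed.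

Lemma levi_mul_xrad' i g v a : levi i g -> off i v ->
  (g * xrad (iopp i) v a = xrad (iopp i) (act g v) a * g)%g.
Proof. by case=> _ _ _ H; exact: H. Qed.

Lemma levi_xlong_comm i g a : levi i g -> commute g (xlong i a).
Proof. by move=> L; rewrite -xrad0 /commute levi_mul_xrad ?act0 //; exact: off0. Qed.

Lemma mulVg_eq (x y z : G) : (y = x * z)%g -> (x^-1 * y = z)%g.
Proof. by move=> ->; rewrite mulKg. Qed.

Lemma commute_lconjr (g y s : G) : commute (lconj g^-1%g y) s -> commute y (lconj g s).
Proof.
move=> /lconj_id e; apply: commute_lconj; rewrite -lconj_lconj.
have -> : (y * g)%g = (g * lconj g^-1 y)%g by rewrite /lconj invgK !mulgA mulgV mul1g.
by rewrite lconj_lconj e.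
Qed.

Lemma levi_lconj_xrad i g v a : levi i g -> off i v ->
  lconj g (xrad i v a) = xrad i (act g v) a.
Proof. by move=> L o; apply/lconj_eq/levi_mul_xrad. Qed.

Lemma levi_lconj_xrad' i g v a : levi i g -> off i v ->
  lconj g (xrad (iopp i) v a) = xrad (iopp i) (act g v) a.
Proof. by move=> L o; apply/lconj_eq/levi_mul_xrad'. Qed.

Lemma lconj_xrad_xrad i j w b v a : i.2 != j.2 -> off i w -> off j w -> off j v ->
  lconj (xrad i w b) (xrad j v a) = xrad j (transv (ebas i) w b v) a.
Proof. by move=> *; apply/lconj_eq/xrad_mul_xrad. Qed.

Lemma xrad_xrad_comm i j w b v a : i.2 != j.2 -> off i w -> off j w -> off j v ->
  form (ebas i) v = 0 -> form w v = 0 -> commute (xrad i w b) (xrad j v a).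
Proof. by move=> *; apply: commute_lconj; rewrite lconj_xrad_xrad // transv_id. Qed.

(** * Conjugating radical elements *)
Lemma transv_opp i w c : off i w ->
  transv (ebas i) w 0 (c *: ebas (iopp i)) = c *: ebas (iopp i) + (c * eps i) *: w.
Proof.
move=> ow; have := offC ow => ow'.
rewrite transvE !formZr (off_form' ow') form_e oppK eqxx mulr1.
by rewrite mulr0 mul0r addr0 scale0r addr0.
Qed.

Lemma lconj_xrad_opp i j w c a : i.2 != j.2 -> off i w -> off j w ->
  lconj (xrad i w 0) (xrad j (c *: ebas (iopp i)) a) =
  (xrad j (c *: ebas (iopp i)) a * xrad j ((c * eps i) *: w) 0)%g.
Proof.
move=> ij oi oj; have ji := far_sym ij; have oe : off j (c *: ebas (iopp i)) by exact/offZ/off_ebas.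
rewrite lconj_xrad_xrad // transv_opp // xradM // formZl formZr (off_form (offC oi)) !mulr0.
by rewrite !addr0.
Qed.

(** Lifts T(e_{-i} + c eps_i e_j, 0, a) in two ways. *)
Lemma lconj_short_long i j c a : i.2 != j.2 ->
  lconj (xrad j (c *: ebas i) 0) (xlong (iopp i) a) =
  (xrad j ((a * c * eps i) *: ebas (iopp i)) (a * c ^+ 2) * xlong (iopp i) a)%g.
Proof.
move=> ij; have ji := far_sym ij; apply: lconj_eq.
have /= := xlong_mul_short (s := T) (i := iopp i) a c ij; rewrite oppK eps_opp => e.
rewrite xrad_ebas // xshortC //.
have oe x : off j (x *: ebas (iopp i)) by exact/offZ/off_ebas.
apply: (@mulgI _ (xshort (iopp i) j (a * c * - eps i) * xlong j (- (a * c ^+ 2)))%g).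
rewrite -e.
have -> : (xshort (iopp i) j (a * c * - eps i) * xlong j (- (a * c ^+ 2)))%g =
  (xrad j ((a * c * eps i) *: ebas (iopp i)) (a * c ^+ 2))^-1%g.
  by rewrite xradV // -scaleNr xrad_split // xrad_ebas // xshortC // mulrN.
by rewrite -!mulgA mulKg.
Qed.

(** This is [lconj_xrad_opp] with the conjugating and the conjugated element
    exchanged. *)
Lemma lconj_short_xrad i j c v : i.2 != j.2 -> off i v -> off j v ->
  lconj (xrad j (c *: ebas i) 0) (xrad (iopp i) v 0) =
  (xrad j ((c * eps i) *: v) 0 * xrad (iopp i) v 0)%g.
Proof.
move=> ij oi oj; have ji := far_sym ij; apply: lconj_eq.
have oe x : off j (x *: ebas i) by exact/offZ/off_ebas.
have e := @lconj_xrad_opp (iopp i) j v c 0 ij (offC oi) oj.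
rewrite !oppK eps_opp in e; have {}e := mulg_lconj (xrad (iopp i) v 0) (xrad j (c *: ebas i) 0).
rewrite (@lconj_xrad_xrad (iopp i) j) // in e; last exact: offC.
have etr : transv (ebas (iopp i)) v 0 (c *: ebas i) = c *: ebas i - (c * eps i) *: v.
  by have := transv_opp c (offC oi); rewrite oppK eps_opp mulrN scaleNr.
rewrite etr in e.
rewrite -mulgA e mulgA xradM; last exact: offZ.
rewrite formDr formNr form_alt formZr formZl (off_form' oi).
by rewrite !mulr0 oppr0 !addr0 [_ *: v + _]addrC subrK.
Qed.

(** * Lifts of T(v, 0, a) for v off a line *)

(** T(e_i, v, 0) sends e_{-i} to e_{-i} + eps_i v, hence conjugates T(e_{-i}, 0, a)
    to T(e_{-i} + eps_i v, 0, a) = T(e_{-i}, a eps_i v, a) T(v, 0, a). *)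
Definition tlong i v a : G := locked
  ((xrad (iopp i) ((a * eps i) *: v) a)^-1 * lconj (xrad i v 0) (xlong (iopp i) a))%g.

Lemma tlongE i v a : tlong i v a =
  ((xrad (iopp i) ((a * eps i) *: v) a)^-1 * lconj (xrad i v 0) (xlong (iopp i) a))%g.
Proof. by rewrite /tlong -lock. Qed.

Lemma lconj_xrad_long i v a : lconj (xrad i v 0) (xlong (iopp i) a) =
  (xrad (iopp i) ((a * eps i) *: v) a * tlong i v a)%g.
Proof. by rewrite tlongE mulVKg. Qed.

(** The formula for [tlong i] only involves the two radicals at e_i and e_{-i}
    and a long root element fixed by g. *)
Lemma levi_lconj_tlong i g v a : levi i g -> off i v ->
  lconj g (tlong i v a) = tlong i (act g v) a.
Proof.
move=> L o; rewrite !tlongE lconjM lconjV levi_lconj_xrad' ?actZ //; last exact: offZ.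
congr (_ * _)%g; rewrite -lconj_lconj levi_mul_xrad // lconj_lconj; congr lconj.
exact/lconj_id/levi_xlong_comm/levi_opp.
Qed.

Lemma levi_tlong_comm i g v a : levi i g -> off i v -> act g v = v ->
  commute g (tlong i v a).
Proof. by move=> L o e; apply: commute_lconj; rewrite levi_lconj_tlong // e. Qed.

Lemma tlong_scalar0 i v : off i v -> tlong i v 0 = 1%g.
Proof. by move=> o; rewrite tlongE mul0r scale0r xrad0 xlong0 /lconj mulg1 mulgV invg1 mulg1. Qed.

Lemma tlong_vector0 i a : tlong i 0 a = 1%g.
Proof. by rewrite tlongE scaler0 !xrad0 xlong0 /lconj mul1g invg1 mulg1 mulVg. Qed.

(** The short root element is the lift of T(e_{-i}, c e_j, 0), which T(e_i, w, 0)
    conjugates to T(e_{-i}, c e_j, 0) T(e_j, multiple of w, 0); both factors fix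
    e_{-i}. *)
Lemma tlong_short_opp_comm i j w c a : i.2 != j.2 -> off i w -> off j w ->
  commute (xshort (iopp i) j c) (tlong i w a).
Proof.
move=> ij oi oj; have ji := far_sym ij.
have oe x : off j (x *: ebas (iopp i)) by exact/offZ/off_ebas.
have oj' : off (iopp i) (c *: ebas j) by exact/offZ/off_ebas.
have ow x : off (iopp i) (x *: w) by exact/offZ/offC.
rewrite tlongE -xrad_ebas //; apply: commuteM.
  by apply/commuteV/xrad_comm; rewrite // formZl formZr (off_form oj) !mulr0.
apply: commute_lconjr; rewrite xrad_ebasC // xradV // oppr0 lconj_xrad_opp //; try exact: offN.
apply: commuteMl; first by rewrite -xrad_ebasC //; apply/commute_sym/xlong_xrad_comm.
by apply: levi_xlong_comm; apply: levi_xrad => //; do ?apply: offZ; do ?apply: offN => //; exact: offC.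
Qed.

(** Both factors in the definition of [tlong i w a] change when they are
    conjugated, as the short root element moves e_{-i}, but by elements that
    cancel. *)
Lemma tlong_short_comm i j w c a : i.2 != j.2 -> off i w -> off j w ->
  commute (xshort i j c) (tlong i w a).
Proof.
move=> ij oi oj; have ji := far_sym ij.
have oe x : off j (x *: ebas (iopp i)) by exact/offZ/off_ebas.
have oe' x : off i (x *: ebas j) by exact/offZ/off_ebas.
have oi' := offC oi.
have oe'' x : off (iopp i) (x *: ebas j) by exact/offC.
have zi x : off i (x *: w) by exact: offZ.
have zi' x : off (iopp i) (x *: w) by exact: offZ.
have zj x : off j (x *: w) by exact: offZ.
rewrite -xrad_ebas // xrad_ebasC //; set y := xrad j _ 0; set s := xlong (iopp i) a.
set A := xrad j ((a * c) *: w) 0; set B := xrad (iopp i) ((a * eps i) *: w) 0.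
set Q := xrad j ((a * c * eps i) *: ebas (iopp i)) (a * c ^+ 2).
have fw x : form (ebas (iopp i)) (x *: w) = 0 by exact: off_form.
have hA : commute A B.
  by apply: commute_sym; apply: xrad_xrad_comm; rewrite // ?oppK ?formZl ?formZr ?form_alt ?mulr0 //; exact: off_form.
have hAs : commute A s by apply: levi_xlong_comm; exact: levi_xrad.
have hB : commute B s by exact/commute_sym/xlong_xrad_comm.
have hQs : commute Q s.
  rewrite /Q xrad_split // -xrad_ebasC //; apply: commuteMl; first exact/commute_sym/xlong_xrad_comm.
  by apply: xlong_comm; rewrite oppK; exact: far_neq.
have eB : xrad (iopp i) ((a * eps i) *: w) a = (B * s)%g by exact: xrad_split.
have h1 : lconj y (xrad (iopp i) ((a * eps i) *: w) a) = (A * B * (Q * s))%g.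
  rewrite eB lconjM lconj_short_xrad // lconj_short_long // scalerA.
  have -> : c * eps i * (a * eps i) = a * c * (eps i * eps i) by ring.
  by rewrite sqr_eps mulr1.
have yw : commute y (xrad i w 0).
  by rewrite /y -xrad_ebasC //; apply: xrad_comm; rewrite // formZl (off_form oj) mulr0.
have h2 : lconj y (lconj (xrad i w 0) s) = (Q * A * (B * s * tlong i w a))%g.
  rewrite -lconj_lconj yw lconj_lconj lconj_short_long // lconjM lconj_xrad_opp // lconj_xrad_long eB -[_ * eps i * eps i]mulrA sqr_eps mulr1.
  by [].
have h3 : commute Q A by apply: xrad_comm; rewrite ?formZl ?fw ?mulr0.
have h4 : commute Q B.
  rewrite /Q xrad_split // -xrad_ebasC //; apply: commuteMl.
    by apply: xrad_comm; rewrite // formZl formZr (off_form oj) !mulr0.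
  by apply: commute_sym; apply: levi_xlong_comm; exact: levi_xrad.
apply: commute_lconj; rewrite [in LHS]tlongE lconjM lconjV h1 h2; apply: mulVg_eq.
by commute_eq.
Qed.

(** * Independence of the line used *)

(** On the vector p = c e_{-i} + e_{-j}, the transvections T(e_i, w, 0) and
    T(e_j, d w, 0) have the same effect for d = c eps_i eps_j, so they conjugate
    T(p, 0, a) to the same transvection. Writing T(p, 0, a) as a product of root
    elements, the conjugates involve [tlong i w (a c^2)] and [tlong j (d w) a]
    respectively, and all other factors agree. The equality of the two
    conjugates in the Steinberg group holds because T(p, 0, a) is a conjugate of
    T(e_{-j}, 0, a) by a short root element y. *)
Lemma tlong_change_line_sign i j w a c : i.2 != j.2 -> off i w -> off j w ->
  tlong i w (a * c ^+ 2) = tlong j ((c * eps i * eps j) *: w) a.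
Proof.
move=> ij oi oj; have ji := far_sym ij.
have ij' : i.2 != (iopp j).2 by []. have ji' : j.2 != (iopp i).2 by [].
have [oi' oj'] := (offC oi, offC oj).
set d := c * eps i * eps j; pose t := c * eps j.
have zi x : off i (x *: w) by exact: offZ.
have zi' x : off (iopp i) (x *: w) by exact: offZ.
have zj x : off j (x *: w) by exact: offZ.
have zj' x : off (iopp j) (x *: w) by exact: offZ.
pose r := xlong (iopp j) a; pose s := xlong (iopp i) (a * c ^+ 2).
(* y maps e_{-j} to p = c e_{-i} + e_{-j}. *)
pose y := xrad j (t *: ebas (iopp i)) 0.
pose Yb := xrad (iopp j) ((a * c) *: ebas (iopp i)) 0.
have Yb2 : Yb = xrad (iopp i) ((a * c) *: ebas (iopp j)) 0 by rewrite /Yb xrad_ebasC.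
have eP : lconj y r = (Yb * s * r)%g.
  rewrite /y xrad_ebasC // lconj_short_long // /t Yb2 xrad_split; last exact/offZ/off_ebas.
  have -> : a * (c * eps j) * eps j = a * c by case: (epsP R j) => ->; ring.
  have -> : a * (c * eps j) ^+ 2 = a * c ^+ 2 by case: (epsP R j) => ->; ring.
  by [].
pose Ei := xrad i w 0; pose Ej := xrad j (d *: w) 0.
have hy : lconj Ei y = (y * Ej)%g.
  have e : d = t * eps i by rewrite /t /d; ring.
  rewrite /Ej e; exact: lconj_xrad_opp.
have hr : commute Ei r by apply: levi_xlong_comm; exact: levi_xrad.
have yE : commute y Ej.
  by apply: xrad_comm; rewrite // ?formZl ?formZr ?(off_form oi') ?mulr0 //; exact/offZ/off_ebas.
(* Ei y = y Ej Ei and Ej y = y Ej, where Ei commutes with r. *)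
have key : lconj Ei (lconj y r) = lconj Ej (lconj y r).
  by rewrite -!lconj_lconj mulg_lconj hy lconj_lconj (lconj_id hr) yE.
pose A := xrad (iopp j) ((a * c * eps i) *: w) 0.
pose B := xrad (iopp i) ((a * c ^+ 2 * eps i) *: w) 0.
have L : lconj Ei (lconj y r) = (Yb * A * (B * s * tlong i w (a * c ^+ 2)%R) * r)%g.
  rewrite eP !lconjM (lconj_id hr) /Yb lconj_xrad_opp // lconj_xrad_long.
  by rewrite (xrad_split (i := iopp i) (a * c ^+ 2)).
have Ejs : commute Ej s by apply: levi_xlong_comm; exact: levi_xrad.
have RR : lconj Ej (lconj y r) = (Yb * B * s * (A * r * tlong j (d *: w) a))%g.
  rewrite eP !lconjM (lconj_id Ejs) Yb2 lconj_xrad_opp // lconj_xrad_long !scalerA.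
  have -> : a * c * eps j * d = a * c ^+ 2 * eps i.
    by rewrite /d; case: (epsP R j) => ->; ring.
  have -> : a * eps j * d = a * c * eps i.
    by rewrite /d; case: (epsP R j) => ->; ring.
  by rewrite (xrad_split (i := iopp j) a).
have c1 : commute A B.
  by apply: xrad_xrad_comm; rewrite // ?formZl ?formZr ?form_alt ?(off_form oj') ?mulr0.
have c2 : commute A s by apply: levi_xlong_comm; exact: levi_xrad.
have c3 : commute A r by exact/commute_sym/xlong_xrad_comm.
have c4 : commute B s by exact/commute_sym/xlong_xrad_comm.
have c5 : commute B r by apply: levi_xlong_comm; exact: levi_xrad.
have c6 : commute s r by apply: xlong_comm; rewrite oppK; exact: far_neq.
have c7 : commute r (tlong i w (a * c ^+ 2)).
  apply: levi_tlong_comm => //; first exact: levi_xlong.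
  by rewrite act_xlong transv_id ?form0l // off_form.
have : (Yb * B * s * A * r * tlong i w (a * c ^+ 2)%R = Yb * B * s * A * r * tlong j (d *: w) a)%g.
  transitivity (lconj Ej (lconj y r)); last by rewrite RR !mulgA.
  rewrite -key L; by commute_eq.
by move/mulgI.
Qed.

(** The signs disappear as c may be replaced by c eps_i eps_j. *)
Lemma tlong_change_line i j w a c : i.2 != j.2 -> off i w -> off j w ->
  tlong j (c *: w) a = tlong i w (a * c ^+ 2).
Proof.
move=> ij oi oj.
have := tlong_change_line_sign a (c * eps i * eps j) ij oi oj.
have -> : c * eps i * eps j * eps i * eps j = c by case: (epsP R i) (epsP R j) => -> [] ->; ring.
by move=> <-; congr tlong; case: (epsP R i) (epsP R j) => -> [] ->; ring.
Qed.

Lemma tlong_indep i j w a : i.2 != j.2 -> off i w -> off j w ->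
  tlong i w a = tlong j w a.
Proof. by move=> ij oi oj; rewrite -[w in RHS]scale1r (tlong_change_line _ _ ij) // expr1n mulr1. Qed.

Lemma tlong_opp i j w a : i.2 != j.2 -> off i w -> off j w ->
  tlong (iopp i) w a = tlong i w a.
Proof. by move=> ij oi oj; rewrite (@tlong_indep i j) // (@tlong_indep (iopp i) j) //; exact: offC. Qed.

Lemma tlongZ i j w a c : i.2 != j.2 -> off i w -> off j w ->
  tlong i (c *: w) a = tlong i w (a * c ^+ 2).
Proof.
move=> ij oi oj; rewrite (tlong_change_line _ _ (far_sym ij)) //.
by rewrite (@tlong_indep j i) // far_sym.
Qed.

Lemma levi_tlong i j w a : i.2 != j.2 -> off i w -> off j w -> levi i (tlong j w a).
Proof.
move=> ij oi oj; have oj' := offC oj; rewrite tlongE /lconj.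
have L1 : levi i (xrad j w 0) by exact: levi_xrad.
apply: leviM; first by apply: leviV; apply: levi_xrad => //; exact: offZ.
by apply: leviM; [apply: leviM => //; exact: levi_xlong | exact: leviV].
Qed.

(** Through the other line j, on which w vanishes, [tlong i w a] is seen to be
    preserved by [xrad i (b w) c], which fixes w. *)
Lemma tlong_xrad_comm i j w a b c : i.2 != j.2 -> off i w -> off j w ->
  commute (tlong i w a) (xrad i (b *: w) c).
Proof.
move=> ij oi oj; rewrite (@tlong_indep i j) //; apply: commute_sym.
have oz := offZ b oi.
apply: levi_tlong_comm => //; first by apply: levi_xrad => //; [exact: far_sym | exact: offZ].
by rewrite act_xrad // transv_id ?formZl ?form_alt ?mulr0 // off_form.
Qed.

Lemma tlong_xlong_comm i j w a c : i.2 != j.2 -> off i w -> off j w ->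
  commute (tlong i w a) (xlong i c).
Proof. by move=> ij oi oj; rewrite -xrad0 -(scale0r w); exact: tlong_xrad_comm ij oi oj. Qed.

(** Additivity is inherited from the long root elements, because [tlong i w a]
    commutes with the radical elements that appear in between. *)
Lemma tlongD i j w a b : i.2 != j.2 -> off i w -> off j w ->
  tlong i w (a + b) = (tlong i w a * tlong i w b)%g.
Proof.
move=> ij oi oj; have oi' := offC oi.
have z x : off (iopp i) (x *: w) by exact: offZ.
apply: (@mulgI _ (xrad (iopp i) (((a + b) * eps i) *: w) (a + b))).
rewrite -lconj_xrad_long xlongD lconjM !lconj_xrad_long.
have -> : xrad (iopp i) (((a + b) * eps i) *: w) (a + b) =
  (xrad (iopp i) ((a * eps i) *: w) a * xrad (iopp i) ((b * eps i) *: w) b)%g.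
  by rewrite xradM // formZl formZr form_alt !mulr0 addr0 -scalerDl mulrDl.
have c : commute (tlong i w a) (xrad (iopp i) ((b * eps i) *: w) b).
  by rewrite -(@tlong_opp i j) //; apply: (@tlong_xrad_comm (iopp i) j).
by commute_eq.
Qed.

(** The conjugate of T(x, 0, a) by s is T(s x, 0, a), as s preserves the form. *)
Lemma act_lconj_long g i a u :
  act (lconj g (xlong i a)) u = transv (act g (ebas i)) 0 a u.
Proof.
rewrite /lconj !actM act_xlong !transvE !form0l !add0r !scaler0 !addr0 actD actZ actVK.
by rewrite -[form _ (act g^-1%g u)](act_form g) actVK.
Qed.

Lemma act_tlong j w a u : off j w -> act (tlong j w a) u = transv w 0 a u.
Proof.
move=> oj; have oj' := offC oj.
have z x : off (iopp j) (x *: w) by exact: offZ.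
rewrite tlongE xradV // actM act_lconj_long !act_xrad //; last exact: offN.
have := transv_opp 1 oj; rewrite !scale1r mul1r => ->.
rewrite !transvE !(formDl, formDr, formZl, formZr, form0l, form0r, formNl, form_alt).
rewrite (off_form oj') (off_form' oj').
set x := form w u; set y := form _ u.
apply/ffunP => m; rewrite !ffunE /GRing.scale /=.
by case: (epsP R j) => ->; ring.
Qed.

Hypothesis l3 : (3 <= l)%N.

(** * Vectors supported on one line *)

(** The index is chosen positive, so that its sign is 1. *)
Lemma exists_third_line i j : exists m : idx, [/\ m.1 = true, i.2 != m.2 & j.2 != m.2].
Proof.
have : (#|[set i.2; j.2]| < #|'I_l|)%N.
  by rewrite card_ord; apply: leq_ltn_trans l3; rewrite cards2; case: (_ != _).
rewrite -cardsT => lt.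
have /subsetPn[n _] : ~~ ([set: 'I_l] \subset [set i.2; j.2]).
  by apply: contraL lt => /subset_leq_card; rewrite -leqNgt.
rewrite !inE negb_or => /andP[n1 n2]; exists (true, n).
by split=> //; rewrite eq_sym.
Qed.

(** A vector of the line of i; it is off every other line ([on_off]), hence off at
    least two lines. *)
Definition on i (h : V) := forall k, k.2 != i.2 -> h k = 0.

Lemma on_off i j h : on i h -> i.2 != j.2 -> off j h.
Proof. by move=> o ij; split; apply: o; rewrite // eq_sym. Qed.

Lemma on_sum i h : on i h -> h = h i *: ebas i + h (iopp i) *: ebas (iopp i).
Proof.
move=> o; apply/ffunP => m; rewrite !ffunE /GRing.scale /=.
have [e|ne] := eqVneq m.2 i.2; last first.
  rewrite o // (negPf (far_neq ne)) (negPf (far_opp ne)) !mulr0 addr0 //.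
case: (same_line (esym e)) => ->; rewrite eqxx.
  by rewrite (negPf (neq_opp i)) mulr1 mulr0 addr0.
by rewrite (negPf (opp_neq i)) mulr1 mulr0 add0r.
Qed.

Lemma onZ i c h : on i h -> on i (c *: h).
Proof. by move=> o k ki; rewrite ffunE o // /GRing.scale /= mulr0. Qed.

Lemma on_form i h v : on i h -> off i v -> form h v = 0.
Proof.
move=> o ov; rewrite (on_sum o) formDl !formZl (off_form ov) (off_form (offC ov)).
by rewrite !mulr0 addr0.
Qed.

(** If j and p are on the same line, the comparison passes through a third
    one. *)
Lemma tlong_on_indep i j p h a : on i h -> i.2 != j.2 -> i.2 != p.2 ->
  tlong j h a = tlong p h a.
Proof.
move=> o ij ip; have [e|ne] := eqVneq j.2 p.2; last first.
  by apply: tlong_indep => //; exact: (on_off o).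
have [m [_ im jm]] := exists_third_line i j.
transitivity (tlong m h a); first by apply: tlong_indep => //; exact: (on_off o).
by symmetry; apply: tlong_indep; rewrite -?e //; exact: (on_off o).
Qed.

(** For h on the line of i this yields that [tlong j h a] commutes with all root
    elements that do not involve that line, j being arbitrary. The lift may be
    computed with the line of p itself, where the claim is known for each root
    element. *)
Lemma tlong_on_xrad_comm i j p h w a b : on i h -> i.2 != j.2 -> i.2 != p.2 ->
  off i w -> off p w -> commute (tlong j h a) (xrad p w b).
Proof.
move=> o ij ip oi op; rewrite (tlong_on_indep a o ij ip); have op' := on_off o ip.
apply: (xrad_ind (P := fun w b x => commute (tlong p h a) x)) => // [c|k pk|u v c d x y _ _].
- have [m [_ im pm]] := exists_third_line i p.
  by apply: (tlong_xlong_comm (j := m)) => //; exact: (on_off o).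
- have [e|ne] := eqVneq k.2 i.2.
    by rewrite (offE oi e) xshort0 //; exact: commute1.
  by apply/commute_sym/tlong_short_comm => //; apply: (on_off o); rewrite eq_sym.
- exact: commuteM.
Qed.

Lemma tlong_on_xlong_comm i j p h a b : on i h -> i.2 != j.2 -> i.2 != p.2 ->
  commute (tlong j h a) (xlong p b).
Proof. by move=> o ij ip; rewrite -xrad0; apply: (tlong_on_xrad_comm _ _ o) => //; exact: off0. Qed.

Lemma commute_tlong x p w b : commute x (xrad p w 0) -> commute x (xlong (iopp p) b) ->
  commute x (xrad (iopp p) ((b * eps p) *: w) b) -> commute x (tlong p w b).
Proof.
move=> c1 c2 c3; rewrite tlongE /lconj; apply: commuteM; first exact: commuteV.
by apply: commuteM; [exact: commuteM | exact: commuteV].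
Qed.

Lemma tlong_on_tlong_comm i j p h w a b : on i h -> i.2 != j.2 -> i.2 != p.2 ->
  off i w -> off p w -> commute (tlong j h a) (tlong p w b).
Proof.
move=> o ij ip oi op; apply: commute_tlong.
- exact: (tlong_on_xrad_comm _ _ o).
- exact: (tlong_on_xlong_comm _ _ o).
- by apply: (tlong_on_xrad_comm _ _ o) => //; apply: offZ => //; exact: offC.
Qed.

(** * Lifts of T(w, k, 0) for k on a line *)

(** The lift of T(w, k, 0) for k = x e_j + y e_{-j} and w off the line of j. As
    T(w, x e_j, 0) T(w, y e_{-j}, 0) = T(w, k, eps_j x y), a lift of T(w, 0, _) has
    to correct the product. Only the components of k on the line of j matter. *)
Definition tplane j w (k : V) : G := locked
  (xrad j (k j *: w) 0 * xrad (iopp j) (k (iopp j) *: w) 0 *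
   tlong j w (- (eps j * k j * k (iopp j))))%g.

Lemma tplaneE j w (k : V) : tplane j w k =
  (xrad j (k j *: w) 0 * xrad (iopp j) (k (iopp j) *: w) 0 *
   tlong j w (- (eps j * k j * k (iopp j))))%g.
Proof. by rewrite /tplane -lock. Qed.

Lemma commute_tplane x j w (k : V) : (forall c, commute x (xrad j (c *: w) 0)) ->
  (forall c, commute x (xrad (iopp j) (c *: w) 0)) ->
  (forall c, commute x (tlong j w c)) -> commute x (tplane j w k).
Proof. by move=> c1 c2 c3; rewrite tplaneE; do 2?apply: commuteM. Qed.

Lemma levi_tplane i j w (k : V) : i.2 != j.2 -> off i w -> off j w ->
  levi i (tplane j w k).
Proof.
move=> ij oi oj; rewrite tplaneE; apply: leviM; last exact: levi_tlong.
by apply: leviM; apply: levi_xrad => //; apply: offZ => //; exact: offC.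
Qed.

Lemma act_tplane j w (k : V) u : off j w -> on j k ->
  act (tplane j w k) u = transv w k 0 u.
Proof.
move=> oj ok; have oj' := offC oj.
rewrite tplaneE !actM act_tlong // !act_xrad; try exact: offZ.
rewrite [in RHS](on_sum ok); set x := k j; set y := k _.
rewrite !transvE !(formDl, formDr, formZl, formZr, form0l, form0r, form_alt).
rewrite (off_form oj') (off_form oj) (off_form' oj').
set f := form w u; set g := form (ebas j) u; set g' := form _ u.
rewrite !form_e oppK eqxx.
apply/ffunP => m; rewrite !ffunE /GRing.scale /=; ring.
Qed.

(** T(w, k, 0) fixes the vectors orthogonal to w and k, in particular w and k
    themselves. *)
Lemma tplane_xrad_comm i j w (k : V) v a : i.2 != j.2 -> off i w -> off j w ->
  on j k -> off i v ->
  form w v = 0 -> form k v = 0 -> commute (tplane j w k) (xrad i v a).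
Proof.
move=> ij oi oj ok ov f1 f2; have L := levi_tplane k ij oi oj.
by rewrite /commute (levi_mul_xrad _ L) // act_tplane // transv_id.
Qed.

Lemma tplane_tlong_comm i j w (k : V) v a : i.2 != j.2 -> off i w -> off j w ->
  on j k -> off i v ->
  form w v = 0 -> form k v = 0 -> commute (tplane j w k) (tlong i v a).
Proof.
move=> ij oi oj ok ov f1 f2; apply: levi_tlong_comm => //; first exact: levi_tplane.
by rewrite act_tplane // transv_id.
Qed.

Lemma tplane_tplane_comm i j w (k : V) v u : i.2 != j.2 -> off i w -> off j w ->
  on j k -> off i v ->
  form w v = 0 -> form k v = 0 -> commute (tplane j w k) (tplane i v u).
Proof.
move=> ij oi oj ok ov f1 f2; apply: commute_tplane => c.
- by apply: tplane_xrad_comm; rewrite // ?formZr ?f1 ?f2 ?mulr0 //; exact: offZ.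
- apply: tplane_xrad_comm; rewrite // ?formZr ?f1 ?f2 ?mulr0 //; first exact: offC.
  by apply: offZ; exact: offC.
- exact: tplane_tlong_comm.
Qed.

(** Conjugating a long root element at e_{-i} by T(e_i, y w, 0) T(e_i, z w, 0) at
    once and in two steps gives radical elements at e_{-i} and lifts of
    transvections along w. The parameters of the latter are (y + z)^2 and
    y^2 + z^2 respectively, whence the factor 2. *)
Lemma lconj_xrad_same_vector i j w x y : i.2 != j.2 -> off i w -> off j w ->
  lconj (xrad i (y *: w) 0) (xrad (iopp i) (x *: w) 0) =
  (xrad (iopp i) (x *: w) 0 * tlong i w (2%:R * eps i * x * y))%g.
Proof.
move=> ij oi oj.
(* The long root element at e_{-i} with parameter 1, conjugated by T(e_i, z w, 0),
   involves the radical element at e_{-i} with parameter x w. *)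
pose z := eps i * x.
have oi' := offC oi.
have zo c : off i (c *: w) by exact: offZ.
have zo' c : off (iopp i) (c *: w) by exact: offZ.
have zj c : off j (c *: w) by exact: offZ.
have step c : lconj (xrad i (c *: w) 0) (xlong (iopp i) 1) =
   (xrad (iopp i) ((eps i * c) *: w) 0 * xlong (iopp i) 1 * tlong i w (c ^+ 2))%g.
  by rewrite lconj_xrad_long scalerA mul1r (xrad_split 1) // (tlongZ _ _ ij) // mul1r.
have e1 : xrad i ((y + z) *: w) 0 = (xrad i (y *: w) 0 * xrad i (z *: w) 0)%g.
  by rewrite scalerDl xradD // formZl formZr form_alt !mulr0.
have := step (y + z); rewrite e1 lconj_lconj step !lconjM step.
have c1 : lconj (xrad i (y *: w) 0) (tlong i w (z ^+ 2)) = tlong i w (z ^+ 2).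
  by apply/lconj_id/commute_sym; exact: (tlong_xrad_comm _ _ _ ij).
have -> : eps i * z = x by rewrite /z mulrA sqr_eps mul1r.
rewrite c1 mulrDr scalerDl xradD //; last first.
  by rewrite formZl formZr form_alt !mulr0.
have -> : eps i * z = x by rewrite /z mulrA sqr_eps mul1r.
have -> : (y + z) ^+ 2 = 2%:R * eps i * x * y + y ^+ 2 + z ^+ 2 by rewrite /z; ring.
rewrite !(tlongD _ _ ij) //.
set q := lconj _ _; set A := xrad _ _ _; set B := xrad _ _ _; set s := xlong _ _.
set X1 := tlong i w (y ^+ 2); set X2 := tlong i w (z ^+ 2); set X3 := tlong i w _.
have cX c d : commute (tlong i w c) (tlong i w d) by rewrite /commute -!(tlongD _ _ ij) // addrC.
have cB d c : commute (tlong i w c) (xrad (iopp i) (d *: w) 0).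
  by rewrite -(tlong_opp (j := j)) //; apply: (tlong_xrad_comm (j := j)).
have cs c : commute (tlong i w c) s.
  by rewrite -(tlong_opp (j := j)) //; apply: (tlong_xlong_comm (j := j)).
have d1 : commute X3 A by exact: cB. have d2 : commute X3 s by exact: cs.
have d3 : commute A B by apply: xrad_comm; rewrite // formZl formZr form_alt !mulr0.
move=> e.
apply: (@mulIg _ (A * s * X1 * X2)%g).
transitivity (q * (A * s * X1) * X2)%g; first by rewrite !mulgA.
rewrite e; by commute_eq.
Qed.

Lemma tplaneN i j w (k : V) : i.2 != j.2 -> off i w -> off j w ->
  (tplane j w k * tplane j w (- k) = 1)%g.
Proof.
move=> ij oi oj; have ji := far_sym ij; rewrite !tplaneE !ffunE.
set x := k j; set y := k _.
have -> : - (eps j * - x * - y) = - (eps j * x * y) by ring.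
have ov c : off j (c *: w) by exact: offZ.
have ov' c : off (iopp j) (c *: w) by apply: offZ; exact: offC.
have -> : xrad j ((- x) *: w) 0 = (xrad j (x *: w) 0)^-1%g by rewrite xradV // scaleNr oppr0.
have -> : xrad (iopp j) ((- y) *: w) 0 = (xrad (iopp j) (y *: w) 0)^-1%g.
  by rewrite xradV // scaleNr oppr0.
have cA : commute (tlong j w (- (eps j * x * y))) (xrad j (x *: w) 0) by exact: (tlong_xrad_comm _ _ _ ji).
have cB c : commute (tlong j w c) (xrad (iopp j) (y *: w) 0).
  by rewrite -(tlong_opp (j := i)) //; apply: (tlong_xrad_comm (j := i)) => //; exact: offC.
have c1 := cB (- (eps j * x * y)); have c2 := cB (2%:R * eps j * y * x).
have e := lconj_xrad_same_vector y x ji oj oi; have X0 := tlong_scalar0 oj.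
have XX : (tlong j w (2%:R * eps j * y * x) * tlong j w (- (eps j * x * y)) * tlong j w (- (eps j * x * y)) = 1)%g.
  by rewrite -!(tlongD _ _ ji) // -[RHS]X0; congr tlong; ring.
move: e c1 c2 cA XX; rewrite /lconj.
set A := xrad j _ _; set B := xrad (iopp j) _ _; set X := tlong j w (- _); set X2 := tlong j w _.
move=> e c1 c2 cA XX.
transitivity (A * B * A^-1 * (B^-1 * X * X))%g; first by commute_eq.
rewrite e; transitivity (B * B^-1 * (X2 * X * X))%g; first by commute_eq.
by rewrite XX mulgV mulg1.
Qed.

Lemma tplaneV i j w (k : V) : i.2 != j.2 -> off i w -> off j w ->
  tplane j w (- k) = (tplane j w k)^-1%g.
Proof. by move=> ij oi oj; apply: (@mulgI _ (tplane j w k)); rewrite (tplaneN _ ij) // mulgV. Qed.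

Lemma tplaneZ i j w (k : V) c : i.2 != j.2 -> off i w -> off j w ->
  tplane j (c *: w) k = tplane j w (c *: k).
Proof.
move=> ij oi oj; have ji := far_sym ij; rewrite !tplaneE !coordZ !scalerA (tlongZ _ _ ji) // ![_ * c]mulrC.
have -> : - (eps j * (c * k j) * (c * k (iopp j))) = - (eps j * k j * k (iopp j)) * c ^+ 2 by ring.
by [].
Qed.

Lemma tplane_ext j w (k k' : V) : k j = k' j -> k (iopp j) = k' (iopp j) ->
  tplane j w k = tplane j w k'.
Proof. by rewrite !tplaneE => -> ->. Qed.

(** The commutator of T(e_i, w, 0) and T(e_{-i}, k, 0) is T(w, eps_i k, 0). For k
    on the line of j, the element at e_{-i} is a product of three root elements,
    two of which belong to the radicals at e_j and e_{-j}; conjugating them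
    produces the two radical factors of [tplane j w], and conjugating the long
    root element produces the third. The element Z comes from the long root
    element too, and is absorbed when the first two are put in order. *)
Lemma lconj_xrad_on i j w (k : V) : i.2 != j.2 -> off i w -> off j w -> on j k ->
  lconj (xrad i w 0) (xrad (iopp i) k 0) = (tplane j w (eps i *: k) * xrad (iopp i) k 0)%g.
Proof.
move=> ij oi oj ok; have ji := far_sym ij; have [oi' oj'] := (offC oi, offC oj).
have zo c : off i (c *: w) by exact: offZ.
have zo' c : off (iopp i) (c *: w) by exact: offZ.
have zj c : off j (c *: w) by exact: offZ.
have zj' c : off (iopp j) (c *: w) by exact: offZ.
have oe c : off (iopp i) (c *: ebas j) by exact/offZ/off_ebas.
have oe' c : off (iopp i) (c *: ebas (iopp j)) by exact/offZ/off_ebas.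
have ox c : off j (c *: ebas (iopp i)) by exact/offZ/off_ebas.
have ox' c : off (iopp j) (c *: ebas (iopp i)) by exact/offZ/off_ebas.
pose x := k j; pose y := k (iopp j); pose c := - (eps j * x * y).
pose Xj := xrad j (x *: ebas (iopp i)) 0; pose Bq := xrad (iopp j) (y *: ebas (iopp i)) 0.
pose s := xlong (iopp i) c; pose A := xrad j ((x * eps i) *: w) 0.
pose E' := xrad (iopp j) ((y * eps i) *: w) 0; pose Z := xrad (iopp i) ((c * eps i) *: w) 0.
have Xj2 : Xj = xrad (iopp i) (x *: ebas j) 0 by rewrite /Xj xrad_ebasC.
have Bq2 : Bq = xrad (iopp i) (y *: ebas (iopp j)) 0 by rewrite /Bq xrad_ebasC.
have eK : xrad (iopp i) k 0 = (Xj * Bq * s)%g.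
  rewrite Xj2 Bq2 /s -xrad0 !xradM //; last exact: offD.
  rewrite form0r addr0 !formZl !formZr form_e oppK eqxx -(on_sum ok); congr xrad.
  by rewrite /c /= mulr1; ring.
have eL : lconj (xrad i w 0) (xrad (iopp i) k 0) = (Xj * A * (Bq * E') * (Z * s * tlong i w c))%g.
  by rewrite eK !lconjM lconj_xrad_opp // lconj_xrad_opp // lconj_xrad_long (xrad_split c).
have eD : tplane j w (eps i *: k) = (A * E' * tlong i w c)%g.
  rewrite tplaneE !coordZ ![eps i * k _]mulrC (tlong_indep _ ij) //.
  have -> : - (eps j * (k j * eps i) * (k (iopp j) * eps i)) = c.
    by rewrite /c /x /y; case: (epsP R i) => ->; ring.
  by [].
(* Xj belongs to the radical at e_{-i} as well, where E' acts by moving e_j. *)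
have eX : (E' * Xj = Xj * Z * E')%g.
  have := @lconj_xrad_opp (iopp j) (iopp i) ((y * eps i) *: w) x 0 ji (zj' _) (zo' _).
  rewrite oppK -Xj2 -/E' eps_opp scalerA => {}e; rewrite mulg_lconj e.
  have -> : x * - eps j * (y * eps i) = c * eps i by rewrite /c; ring.
  by [].
have c1 : commute E' Bq.
  by apply: xrad_comm; rewrite // formZl formZr (off_form' oi') !mulr0.
have c2 : commute Z E'.
  apply: commute_sym; apply: xrad_xrad_comm => //; rewrite ?formZl ?formZr ?form_alt ?mulr0 //.
  by rewrite (off_form oj') mulr0.
have c3 : commute Z Bq.
  by rewrite Bq2; apply: xrad_comm; rewrite // formZl formZr (off_form' oj') !mulr0.
have c4 : commute A Xj.
  by apply: xrad_comm; rewrite // formZl formZr (off_form' oi') !mulr0.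
pose X := tlong i w c.
have d1 : commute X Xj by rewrite /X Xj2 xrad_ebas //; apply/commute_sym/tlong_short_opp_comm.
have d2 : commute X Bq by rewrite /X Bq2 xrad_ebas //; apply/commute_sym/tlong_short_opp_comm.
have d3 : commute X s.
  by rewrite /X -(tlong_opp (j := j)) //; apply: (tlong_xlong_comm (j := j)).
rewrite eL eD eK -/X.
transitivity (A * (Xj * Z * E') * Bq * s * X)%g; first by commute_eq.
by rewrite -eX; commute_eq.
Qed.

(** * Additivity and symmetry *)

(** T(k + w, 0, a) = T(k, 0, a) T(w, 0, a) T(w, a k, 0). As T(e_i, k + w, 0) is a
    product, the conjugate defining the left-hand side can be computed in two
    steps; the last factor is the commutator [lconj_xrad_on]. *)
Lemma tlong_addv i j (k : V) w a : i.2 != j.2 -> on j k -> off i w -> off j w ->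
  tlong i (k + w) a = (tlong i k a * tlong i w a * tplane j w (a *: k))%g.
Proof.
move=> ij ok oi oj; have ji := far_sym ij; have ki := on_off ok ji.
have [oi' ki'] := (offC oi, offC ki).
have zk c : off (iopp i) (c *: k) by exact: offZ.
have zw c : off (iopp i) (c *: w) by exact: offZ.
have kw := on_form ok oj; have wk := formC0 kw.
pose c := a * eps i; pose s := xlong (iopp i) a.
pose Ek := xrad (iopp i) (c *: k) 0; pose Ew := xrad (iopp i) (c *: w) 0.
pose D := tplane j w (a *: k).
have e1 : xrad i (k + w) 0 = (xrad i w 0 * xrad i k 0)%g by rewrite addrC xradD.
have c0 : commute (xrad i w 0) (tlong i k a).
  by apply: commute_sym; apply: (tlong_on_xrad_comm _ _ ok).
have e2 : lconj (xrad i w 0) Ek = (D * Ek)%g.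
  rewrite /Ek (lconj_xrad_on ij) //; last exact: onZ.
  by rewrite scalerA /c mulrCA sqr_eps mulr1.
have e3 : xrad (iopp i) (c *: (k + w)) a = (Ek * Ew * s)%g.
  rewrite scalerDr xrad_split; last exact: offD.
  by rewrite xradD // formZl formZr kw !mulr0.
have := lconj_xrad_long i (k + w) a; rewrite -/c e1 e3 lconj_lconj lconj_xrad_long -/c (xrad_split a) // -/Ek -/s.
rewrite !lconjM e2 (lconj_id c0) lconj_xrad_long -/c (xrad_split a) // -/Ew -/s => e.
have oak : on j (a *: k) by exact: onZ.
have DE v b : off (iopp i) v -> form w v = 0 -> form k v = 0 -> commute D (xrad (iopp i) v b).
  by move=> ov f1 f2; apply: (tplane_xrad_comm (i := iopp i)) => //; rewrite formZl f2 mulr0.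
have d1 : commute D Ek by apply: DE; rewrite // formZr ?wk ?form_alt mulr0.
have d2 : commute D Ew by apply: DE; rewrite // formZr ?kw ?form_alt mulr0.
have d3 : commute D s by rewrite /s -xrad0; apply: DE; rewrite ?form0r //; exact: off0.
have d4 : commute D (tlong i k a).
  by apply: tplane_tlong_comm => //; rewrite formZl form_alt mulr0.
have d5 : commute D (tlong i w a).
  by apply: tplane_tlong_comm => //; rewrite ?form_alt // formZl kw mulr0.
have d6 : commute (tlong i k a) (tlong i w a) by apply: (tlong_on_tlong_comm _ _ ok).
apply: (@mulgI _ (Ek * Ew * s)%g); rewrite -e -/D.
have d7 : commute Ew Ek by apply: xrad_comm; rewrite // formZl formZr wk !mulr0.
by commute_eq.
Qed.

(** Two terms T(w, _ k, 0) arise: from exchanging the radical elements for w at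
    e_i and for k at e_{-i}, and from [tlong_addv]. They are inverse to each
    other. *)
Lemma tplane_addv i j (k : V) w u : i.2 != j.2 -> on j k -> off i w -> off j w ->
  tplane i (k + w) u = (tplane i k u * tplane i w u)%g.
Proof.
move=> ij ok oi oj; have ji := far_sym ij; have ki := on_off ok ji.
have [oi' ki'] := (offC oi, offC ki).
have zk c : off i (c *: k) by exact: offZ.
have zw c : off i (c *: w) by exact: offZ.
have zk' c : off (iopp i) (c *: k) by exact: offZ.
have zw' c : off (iopp i) (c *: w) by exact: offZ.
have zjw c : off j (c *: w) by exact: offZ.
have kw := on_form ok oj; have wk := formC0 kw.
have kw0 a b : form (a *: k) (b *: w) = 0 by rewrite formZl formZr kw !mulr0.
rewrite !tplaneE; set x := u i; set y := u (iopp i); pose c := - (eps i * x * y).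
rewrite -/c !scalerDr (tlong_addv _ ij) // !xradD //.
pose D := tplane j w (c *: k).
have e : (xrad i (x *: w) 0 * xrad (iopp i) (y *: k) 0 = D^-1 * xrad (iopp i) (y *: k) 0 * xrad i (x *: w) 0)%g.
  rewrite mulg_lconj (lconj_xrad_on ij) //; last exact: onZ.
  rewrite (tplaneZ _ _ ij) // -(tplaneV _ ij) //.
  have -> : x *: (eps i *: (y *: k)) = - (c *: k).
    by rewrite !scalerA -scaleNr; congr (_ *: _); rewrite /c; ring.
  by [].
have ock : on j (c *: k) by exact: onZ.
have DE p v b : p.2 = i.2 -> off p v -> form w v = 0 -> form k v = 0 -> commute D (xrad p v b).
  move=> pi ov f1 f2; apply: (tplane_xrad_comm (i := p)) => //; first by rewrite pi.
  - by have [->|->] := same_line (esym pi).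
  - by rewrite formZl f2 mulr0.
have d1 : commute D (xrad i (x *: k) 0) by apply: DE; rewrite // formZr ?wk ?form_alt mulr0.
have d2 : commute D (xrad i (x *: w) 0) by apply: DE; rewrite // formZr ?kw ?form_alt mulr0.
have d3 : commute D (xrad (iopp i) (y *: k) 0) by apply: DE; rewrite // formZr ?wk ?form_alt mulr0.
have d4 : commute D (xrad (iopp i) (y *: w) 0) by apply: DE; rewrite // formZr ?kw ?form_alt mulr0.
have d5 : commute D (tlong i k c) by apply: tplane_tlong_comm => //; rewrite formZl form_alt mulr0.
have d6 : commute D (tlong i w c).
  by apply: tplane_tlong_comm => //; rewrite ?form_alt // formZl kw mulr0.
have d7 : commute (tlong i k c) (xrad i (x *: w) 0) by apply: (tlong_on_xrad_comm _ _ ok).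
have d8 : commute (tlong i k c) (xrad (iopp i) (y *: w) 0) by apply: (tlong_on_xrad_comm _ _ ok).
move: e d1 d2 d3 d4 d5 d6 d7 d8; rewrite -/D.
set A1 := xrad i (x *: k) 0; set A2 := xrad i (x *: w) 0.
set B1 := xrad _ (y *: k) 0; set B2 := xrad _ (y *: w) 0.
set X1 := tlong i k c; set X2 := tlong i w c => e d1 d2 d3 d4 d5 d6 d7 d8.
transitivity (A1 * (A2 * B1) * B2 * X1 * X2 * D)%g; first by rewrite !mulgA.
rewrite e; transitivity (A1 * B1 * A2 * B2 * X1 * X2 * (D^-1 * D))%g; first by commute_eq.
rewrite mulVg mulg1; by commute_eq.
Qed.

(** Both sides are the commutator of T(e_m, h, 0) and T(e_{-m}, k, 0) for an index
    m on a third line: [lconj_xrad_on] computes the commutator from either of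
    its two entries, with h or k in the role of the vector on a line. *)
Lemma tplaneC i j h (k : V) : i.2 != j.2 -> on i h -> on j k ->
  tplane j h k = tplane i k h.
Proof.
move=> ij oh ok; have ji := far_sym ij; have [m [m1 im jm]] := exists_third_line i j.
have mi := far_sym im; have mj := far_sym jm.
have em : eps m = 1 by rewrite /Defs.eps m1.
have hm := on_off oh im; have hj := on_off oh ij.
have km := on_off ok jm; have ki := on_off ok ji.
have := lconj_xrad_on mj hm hj ok.
have := lconj_xrad_on (i := iopp m) mi (offC km) ki oh.
rewrite oppK eps_opp em scaleNr !scale1r (tplaneV _ mi) // /lconj => e1 e2.
set A := xrad m h 0 in e1 e2; set B := xrad (iopp m) k 0 in e1 e2.
have eD : tplane j h k = (A * B * A^-1 * B^-1)%g by rewrite e2 mulgK.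
apply: invg_inj; rewrite eD !invgM !invgK !mulgA.
by apply: (@mulIg _ A); rewrite -e1 mulgVK.
Qed.

(** * The factors of T(h + k + w, 0, a) commute *)
Lemma tlong_xrad_on_comm i j (k : V) w a b : i.2 != j.2 -> on j k -> off i w ->
  off j w ->
  commute (tlong i w a) (xrad i k b).
Proof.
move=> ij ok oi oj; have ki := on_off ok (far_sym ij).
apply: (xrad_ind (P := fun v b x => commute (tlong i w a) x)) => // [c|p ip|u v c d x y _ _].
- exact: (tlong_xlong_comm _ _ ij).
- have [e|ne] := eqVneq p.2 j.2; last by rewrite ok // xshort0 //; exact: commute1.
  apply/commute_sym/tlong_short_comm => //.
  by have [->|->] := same_line (esym e); last exact: offC.
- exact: commuteM.
Qed.

Lemma tlong_on_tplane_comm i j h w (k : V) a : i.2 != j.2 -> on i h -> off i w ->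
  off j w ->
  commute (tlong j h a) (tplane j w k).
Proof.
move=> ij oh oi oj; apply: commute_tplane => c.
- by apply: (tlong_on_xrad_comm _ _ oh) => //; exact: offZ.
- by apply: (tlong_on_xrad_comm _ _ oh) => //; apply: offZ => //; exact: offC.
- exact: (tlong_on_tlong_comm _ _ oh).
Qed.

Lemma tlong_on_tplane_self_comm i j h w a : i.2 != j.2 -> on i h -> off i w ->
  off j w ->
  commute (tlong j h a) (tplane i w (a *: h)).
Proof.
move=> ij oh oi oj; have ji := far_sym ij; have hj := on_off oh ij.
apply: commute_sym; apply: tplane_tlong_comm => //; first exact: onZ.
  by rewrite form_anti (on_form oh oi) oppr0.
by rewrite formZl form_alt mulr0.
Qed.

Lemma tlong_on_tplane_vec_comm i j h (k : V) a : i.2 != j.2 -> on i h -> on j k ->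
  commute (tlong j h a) (tplane j h k).
Proof.
move=> ij oh ok; have [m [_ im jm]] := exists_third_line i j.
have hm := on_off oh im; have hj := on_off oh ij; have hj' := offC hj.
apply: commute_tplane => c.
- by apply: (tlong_xrad_comm _ _ _ jm).
- by rewrite -(tlong_opp (j := m)) //; apply: (tlong_xrad_comm (j := m)).
- by rewrite /commute -!(tlongD _ _ jm) // addrC.
Qed.

Lemma tlong_off_tplane_comm i j (k : V) w a u : i.2 != j.2 -> on j k -> off i w ->
  off j w ->
  commute (tlong i w a) (tplane i k u).
Proof.
move=> ij ok oi oj; have ji := far_sym ij; apply: commute_tplane => c.
- by apply: (tlong_xrad_on_comm (j := j)) => //; exact: onZ.
- by rewrite -(tlong_opp (j := j)) //; apply: (tlong_xrad_on_comm (j := j)) => //; [exact: onZ | exact: offC].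
- by apply: commute_sym; apply: (tlong_on_tlong_comm _ _ ok).
Qed.

Lemma tlong_off_tplane_self_comm i j w a u : i.2 != j.2 -> off i w -> off j w ->
  commute (tlong i w a) (tplane i w u).
Proof.
move=> ij oi oj; apply: commute_tplane => c.
- by apply: (tlong_xrad_comm _ _ _ ij).
- by rewrite -(tlong_opp (j := j)) //; apply: (tlong_xrad_comm (j := j)) => //; exact: offC.
- by rewrite /commute -!(tlongD _ _ ij) // addrC.
Qed.

(** Both sides expand to the same six factors, lifts of T(h, 0, a), T(k, 0, a),
    T(w, 0, a), T(h, a k, 0), T(w, a h, 0) and T(w, a k, 0). These transvections
    are along pairwise orthogonal vectors, and their lifts commute. *)
Lemma tfull_sum_sym i j h (k : V) w a : i.2 != j.2 -> on i h -> on j k -> off i w ->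
  off j w ->
  (tlong j h a * tplane i (k + w) (a *: h) * tlong i (k + w) a =
   tlong i k a * tplane j (h + w) (a *: k) * tlong j (h + w) a)%g.
Proof.
move=> ij oh ok oi oj; have ji := far_sym ij; have [m [_ im jm]] := exists_third_line i j.
have hm := on_off oh im; have hj := on_off oh ij.
have km := on_off ok jm; have ki := on_off ok ji.
have hw := on_form oh oi; have kw := on_form ok oj.
have hk := on_form oh ki.
rewrite (tplane_addv _ ij) // (tplane_addv _ ji) // (tlong_addv _ ij) // (tlong_addv _ ji) //.
have eB : tplane j h (a *: k) = tplane i k (a *: h).
  by rewrite (tplaneC ij) //; [rewrite (tplaneZ _ _ (far_sym im)) | exact: onZ].
have eX : tlong j w a = tlong i w a by rewrite (tlong_indep a ij).
have oah : on i (a *: h) by exact: onZ.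
have oak : on j (a *: k) by exact: onZ.
have c1 : commute (tlong j h a) (tlong i k a).
  rewrite (tlong_on_indep a oh ij im) (tlong_on_indep a ok ji jm).
  by apply: (tlong_on_tlong_comm _ _ oh).
have c2 : commute (tlong j h a) (tlong i w a) by rewrite -eX; apply: (tlong_on_tlong_comm _ _ oh).
have c3 : commute (tlong j h a) (tplane i w (a *: h)) by apply: tlong_on_tplane_self_comm.
have c4 : commute (tlong j h a) (tplane j w (a *: k)) by apply: (tlong_on_tplane_comm _ _ ij).
have c5 : commute (tlong j h a) (tplane i k (a *: h)).
  by rewrite -eB; apply: (tlong_on_tplane_vec_comm _ ij).
have c6 : commute (tlong i k a) (tlong i w a) by apply: (tlong_on_tlong_comm _ _ ok).
have c7 : commute (tlong i k a) (tplane j w (a *: k)) by apply: tlong_on_tplane_self_comm.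
have c8 : commute (tlong i k a) (tplane i w (a *: h)) by apply: (tlong_on_tplane_comm _ _ ji).
have c9 : commute (tlong i k a) (tplane i k (a *: h)) by apply: (tlong_on_tplane_vec_comm _ ji).
have d1 : commute (tlong i w a) (tplane i k (a *: h)) by apply: (tlong_off_tplane_comm _ _ ij).
have d2 : commute (tlong i w a) (tplane i w (a *: h)) by apply: (tlong_off_tplane_self_comm _ _ ij).
have d3 : commute (tlong i w a) (tplane j w (a *: k)) by rewrite -eX; apply: (tlong_off_tplane_self_comm _ _ ji).
have d4 : commute (tplane j w (a *: k)) (tplane i w (a *: h)).
  by apply: tplane_tplane_comm => //; rewrite ?form_alt // formZl kw mulr0.
have d5 : commute (tplane j w (a *: k)) (tplane i k (a *: h)).
  by apply: tplane_tplane_comm => //; [rewrite form_anti kw oppr0 | rewrite formZl form_alt mulr0].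
have d6 : commute (tplane i w (a *: h)) (tplane i k (a *: h)).
  rewrite -eB; apply: tplane_tplane_comm => //; [by rewrite form_anti hw oppr0 | by rewrite formZl form_alt mulr0].
rewrite eB eX; by commute_eq.
Qed.

(** * The lift of T(u, 0, a) for an arbitrary vector *)
Definition line_part i u : V := u i *: ebas i + u (iopp i) *: ebas (iopp i).

Lemma on_line_part i u : on i (line_part i u).
Proof.
move=> k ki; rewrite ffunE !coordZ !ffunE (negPf (far_neq ki)) (negPf (far_opp ki)).
by rewrite !mulr0 addr0.
Qed.

Lemma line_part_coord i u k : k.2 = i.2 -> line_part i u k = u k.
Proof.
move=> /esym /same_line [] ->; rewrite ffunE !coordZ !ffunE eqxx.
  by rewrite (negPf (neq_opp i)) mulr1 mulr0 addr0.
by rewrite (negPf (opp_neq i)) mulr1 mulr0 add0r.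
Qed.

Lemma coordB u v k : (u - v) k = u k - v k.
Proof. by rewrite !ffunE. Qed.

Lemma off_line_rest i u : off i (u - line_part i u).
Proof. by split; rewrite coordB line_part_coord // subrr. Qed.

(** The factors lift T(h, 0, a), T(v, a h, 0) and T(v, 0, a), where h is the part of
    u on the line of i and v the rest; the first one is computed with an
    auxiliary line j. *)
Definition tfull i j a u : G :=
  (tlong j (line_part i u) a * tplane i (u - line_part i u) (a *: u) * tlong i (u - line_part i u) a)%g.

Lemma tfull_exchange i j a u : i.2 != j.2 -> tfull i j a u = tfull j i a u.
Proof.
move=> ij; have ji := far_sym ij; rewrite /tfull.
set h := line_part i u; set k := line_part j u; pose w := u - h - k.
have oh : on i h by exact: on_line_part. have ok : on j k by exact: on_line_part.
have e1 : u - h = k + w by rewrite [k + w]addrC /w subrK.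
have e2 : u - k = h + w by rewrite [h + w]addrC /w addrAC subrK.
have oi : off i w.
  by apply: offD; [exact: off_line_rest | apply: offN; exact: (on_off ok ji)].
have oj : off j w.
  by rewrite /w addrAC; apply: offD; [exact: off_line_rest | apply: offN; exact: (on_off oh ij)].
have E (n : idx) v : tplane n v (a *: u) = tplane n v (a *: line_part n u).
  by apply: tplane_ext; rewrite !coordZ line_part_coord.
by rewrite !E -/h -/k e1 e2; exact: tfull_sum_sym.
Qed.

Lemma tfull_indep_second i j p a u : i.2 != j.2 -> i.2 != p.2 ->
  tfull i j a u = tfull i p a u.
Proof. by move=> ij ip; rewrite /tfull (tlong_on_indep a (@on_line_part i u) ij ip). Qed.

Lemma tfull_indep i j p q a u : i.2 != j.2 -> p.2 != q.2 ->
  tfull i j a u = tfull p q a u.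
Proof.
move=> ij pq; have [e|ne] := eqVneq i.2 p.2; last first.
  rewrite (tfull_indep_second a u ij ne) tfull_exchange //; apply: tfull_indep_second => //; exact: far_sym.
have pj : p.2 != j.2 by rewrite -e.
have jp := far_sym pj; have ji := far_sym ij.
transitivity (tfull j i a u); first exact: tfull_exchange.
transitivity (tfull j p a u); first exact: tfull_indep_second.
transitivity (tfull p j a u); first exact: tfull_exchange.
exact: tfull_indep_second.
Qed.

Definition equivariant g := forall i j a u, i.2 != j.2 ->
  lconj g (tfull i j a u) = tfull i j a (act g u).

Lemma actN g u : act g (- u) = - act g u.
Proof. by rewrite -scaleN1r actZ scaleN1r. Qed.

Lemma act_line_part i g u : act g (ebas i) = ebas i ->
  act g (ebas (iopp i)) = ebas (iopp i) ->
  act g (line_part i u) = line_part i u.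
Proof. by move=> gi gi'; rewrite /line_part actD !actZ gi gi'. Qed.

Lemma line_part_act i g u : act g (ebas i) = ebas i ->
  act g (ebas (iopp i)) = ebas (iopp i) ->
  line_part i (act g u) = line_part i u.
Proof.
move=> gi gi'.
have : off i (act g (u - line_part i u)) by apply: act_off => //; exact: off_line_rest.
rewrite actD actN act_line_part //; case; rewrite !coordB !line_part_coord // => /subr0_eq e1 /subr0_eq e2.
by rewrite /line_part e1 e2.
Qed.

(** Such a g fixes the part of u on the line of i and maps the rest to the rest. *)
Lemma levi_lconj_tfull i j g a u : i.2 != j.2 -> levi i g ->
  (forall h, on i h -> commute g (tlong j h a)) -> lconj g (tfull i j a u) = tfull i j a (act g u).
Proof.
move=> ij L c; have [gi gi' _ _] := L.
have ou := off_line_rest i u; have ou' := offC ou.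
have e : act g (u - line_part i u) = act g u - line_part i u by rewrite actD actN act_line_part.
have eu (b : idx) : b.2 = i.2 -> (act g u) b = u b.
  by move=> bi; rewrite -(@line_part_coord i (act g u)) // line_part_act // line_part_coord.
rewrite /tfull !lconjM (levi_lconj_tlong _ L) // e (lconj_id (c _ (@on_line_part i u))) (line_part_act u gi gi').
congr (_ * _ * _)%g; rewrite  !tplaneE !lconjM (levi_lconj_tlong _ L) // (levi_lconj_xrad _ L); last exact: offZ.
rewrite (levi_lconj_xrad' _ L); last exact: offZ.
rewrite !actZ e !coordZ (eu i erefl) (eu (iopp i) erefl); reflexivity.
Qed.

(** By [tfull_indep] the lift may be computed with the line of m, which the
    element does not involve. *)
Lemma equivariant_xrad p w c : (exists m, m.2 != p.2 /\ off m w) -> off p w ->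
  equivariant (xrad p w c).
Proof.
case=> m [mp om] op i j a u ij; have [n [_ mn pn]] := exists_third_line m p.
rewrite (@tfull_indep i j m p) // (@tfull_indep i j m p) //.
apply: levi_lconj_tfull => // [|h oh]; first exact: levi_xrad.
by apply/commute_sym; apply: (tlong_on_xrad_comm _ _ oh).
Qed.

Lemma equivariantM g g' : equivariant g -> equivariant g' -> equivariant (g * g')%g.
Proof. move=> eg eh i j a u ij.
by rewrite lconj_lconj (eh _ _ _ _ ij) (eg _ _ _ _ ij) actM. Qed.

Lemma equivariantV g : equivariant g -> equivariant g^-1%g.
Proof.
move=> eg i j a u ij; rewrite -{1}(actVK g u) -eg // -lconj_lconj mulVg /lconj.
by rewrite mul1g invg1 mulg1.
Qed.

Lemma equivariant1 : equivariant 1%g.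
Proof. by move=> i j a u _; rewrite act1 /lconj mul1g invg1 mulg1. Qed.

Lemma equivariant_xlong p c : equivariant (xlong p c).
Proof.
rewrite -xrad0; apply: equivariant_xrad; last exact: off0.
have [m [_ pm _]] := exists_third_line p p; exists m; split; first exact: far_sym.
exact: off0.
Qed.

Lemma equivariant_xshort p q c : p.2 != q.2 -> equivariant (xshort p q c).
Proof.
move=> pq; rewrite -xrad_ebas //; apply: equivariant_xrad; last exact/offZ/off_ebas.
have [m [_ pm qm]] := exists_third_line p q; exists m; split; first exact: far_sym.
by apply/offZ/off_ebas; exact: far_sym.
Qed.

(** * The lifts at e_i and e_i + e_k *)

(** The relation R4 in disguise. *)
Lemma tlong_ebas i j a : i.2 != j.2 -> tlong j (ebas i) a = xlong i a.
Proof.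
move=> ij; have ji := far_sym ij.
rewrite tlongE; apply: mulVg_eq.
rewrite -[X in xrad j X 0]scale1r xrad_ebasC // lconj_short_long // mulr1 expr1n mulr1.
have o1 : off i ((a * eps j) *: ebas (iopp j)) by exact/offZ/off_ebas.
have o2 : off (iopp j) ((a * eps j) *: ebas i) by exact/offZ/off_ebas.
rewrite (xrad_split _ o1) (xrad_split _ o2) xrad_ebasC // -!mulgA; congr (_ * _)%g.
by apply: xlong_comm; exact: far_opp.
Qed.

Lemma line_partD i u v : line_part i (u + v) = line_part i u + line_part i v.
Proof. by rewrite /line_part !ffunE !scalerDl addrACA. Qed.

Lemma line_part_ebas i : line_part i (ebas i) = ebas i.
Proof.
rewrite /line_part !ffunE eqxx (negPf (opp_neq i)).
by rewrite scale1r scale0r addr0.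
Qed.

Lemma line_part_far i j : i.2 != j.2 -> line_part i (ebas j) = 0.
Proof.
move=> ij; rewrite /line_part !ffunE (negPf (far_neq ij)) eq_oppl (negPf (far_opp ij)).
by rewrite !scale0r addr0.
Qed.

Lemma tfull_ebas i j a : i.2 != j.2 -> tfull i j a (ebas i) = xlong i a.
Proof.
move=> ij; rewrite /tfull line_part_ebas subrr tlong_ebas // tlong_vector0 mulg1 tplaneE.
by rewrite !scaler0 !xrad0 !xlong0 tlong_vector0 !mulg1.
Qed.

Lemma tfull_ebas_add i j a : i.2 != j.2 ->
  tfull i j a (ebas i + ebas j) = (xlong i a * xshort i j a * xlong j a)%g.
Proof.
move=> ij; have oj : off i (ebas j) by exact: off_ebas.
have e : line_part i (ebas i + ebas j) = ebas i.
  by rewrite line_partD line_part_ebas line_part_far // addr0.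
rewrite /tfull e [_ + _ - _]addrC addKr !tlong_ebas // 1?eq_sym //; congr (_ * _ * _)%g.
rewrite tplaneE !coordZ !ffunE eqxx (negPf (far_neq ij)) (negPf (opp_neq i)).
rewrite eq_oppl (negPf (far_opp ij)) !addr0 mulr1 !mulr0 oppr0 scale0r xrad0 xlong0 tlong_scalar0 //.
by rewrite !mulg1 xrad_ebas.
Qed.

Lemma equivariant_commute g : equivariant g -> (forall v, act g v = v) ->
  (forall i a, commute g (xlong i a)) /\ (forall i k a, i.2 != k.2 -> commute g (xshort i k a)).
Proof.
move=> eg ag; have cF i j a u : i.2 != j.2 -> commute g (tfull i j a u).
  by move=> ij; apply: commute_lconj; rewrite (eg _ _ _ _ ij) ag.
have cS i a : commute g (xlong i a).
  by have [m [_ im _]] := exists_third_line i i; rewrite -(tfull_ebas a im); exact: cF.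
split=> // i k a ik.
have -> : xshort i k a = ((xlong i a)^-1 * tfull i k a (ebas i + ebas k) * (xlong k a)^-1)%g.
  by rewrite tfull_ebas_add // !mulgA mulVg mul1g mulgK.
have c1 := cS i a; have c2 := cS k a; have c3 := cF i k a (ebas i + ebas k) ik.
by solve_commute.
Qed.

End TransvectionLifts.

Local Open Scope classical_set_scope.

(** * Centrality *)
Theorem mainTheorem1 (R : comPzRingType) (l : nat) (hl : (3 <= l)%N) :
  K2Sp l R `<=` group_center (StSp l R) /\ central_extension (phi l R).
Proof.
suff key : K2Sp l R `<=` group_center (StSp l R).
  split=> //; split=> // y.
  (* The image of phi is a subgroup of Sp that contains the generators of Ep. *)
  have im : is_subgroup [set s : Sp l R | exists x, val (phi l R x) = s].
    split.
    - by exists 1%g; rewrite gmulf1.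
    - by move=> _ _ [x <-] [x' <-]; exists (x * x')%g; rewrite gmulfM.
    - by move=> _ [x <-]; exists x^-1%g; rewrite gmulfV.
  have /asboolP := valP y; move=> /(_ _ (conj im _)) [|x e].
    by move=> _ [i [j [ij [a ->]]]]; exists (x_ ij a); rewrite phiE.
  by exists x; apply: val_inj.
move=> g kg.
have ag v : St_act g v = v by rewrite /St_act kg.
have eq x : equivariant (T := StSp_datum l R) x.
  elim/St_ind: x => [|x y|x|i a|i k a ik].
  - exact: equivariant1.
  - exact: equivariantM.
  - exact: equivariantV.
  - exact: equivariant_xlong.
  - exact: equivariant_xshort.
have [cS cY] := equivariant_commute hl (eq g) ag.
move=> x; change (commute g x).
elim/St_ind: x => [|x y|x|i a|i k a ik].
- exact: commute1.
- exact: commuteM.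
- exact: commuteV.
- exact: cS.
- exact: cY.
Qed.
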